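(* Assume that $I-P^T$ is invertible and that $\lambda_r>0$ for all $r\in\mathcal R$ (in a critically loaded network, $A\rho=c$, with Markovian routing and proportionally fair allocation, as described in the context). Let $M>0$. For every $\epsilon>0$ there exists a time $T_{M,\epsilon}<\infty$, depending on $M$ and $\epsilon$ but not on the particular fluid model solution, such that for every fluid model solution $n(\cdot)$ with $|n(0)|<M$ there exists a state $n(\infty)\in\mathbb R_+^R$ with $$|n(t)-n(\infty)|<\epsilon\quad\text{for all } t>T_{M,\epsilon}.$$
   Context: Network data. $\mathcal R=\{1,\dots,R\}$ is the set of routes and $\mathcal L=\{1,\dots,L\}$ the set of links. $A$ is an $L\times R$ matrix with entries in $\{0,1\}$, of full row rank, in which every column is nonzero (every route uses at least one link); $c=(c_l)\in(0,\infty)^L$ are the link capacities. $\lambda=(\lambda_r)$ are external arrival rates, $\mu_r>0$ are service rates, $m_r=1/\mu_r$, and $P=(P_{r,s})$ is an $R\times R$ sub-stochastic routing matrix (a job completed on route $r$ moves to route $s$ with probability $P_{r,s}$). The load vector is $\rho=\mathrm{diag}(m)(I-P^T)^{-1}\lambda$, and the network is critically loaded: $A\rho=c$. $|\cdot|$ denotes $|x|=\sum_r|x_r|$. Proportionally fair allocation. Let $\Gamma=\{\gamma\in\mathbb R^R: A\gamma\le c,\ \gamma\ge 0\}$. For $n\in\mathbb R_+^R$, $\Lambda(n)$ is the maximizer over $\gamma\in\Gamma$ of $\sum_{r: n_r>0} n_r\log\gamma_r$, with $\Lambda_r(n)=0$ whenever $n_r=0$. Fluid model. A fluid model solution is an absolutely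 continuous function $n:[0,\infty)\to\mathbb R_+^R$ such that for almost every $t$ there is a vector $\Phi(n(t))\in\mathbb R_+^R$ with $$\dot n_r(t)=\lambda_r-\mu_r\Phi_r(n(t))+\sum_{s\in\mathcal R}P_{s,r}\mu_s\Phi_s(n(t)),\quad r\in\mathcal R,$$ $$\Phi_r(n(t))=\Lambda_r(n(t))\ \text{ if } n_r(t)>0,\qquad \Phi_r(n(t))\in\Big[0,\limsup_{y\to n(t)}\Lambda_r(y)\Big]\ \text{ if } n_r(t)=0,$$ $$\sum_{r\in\mathcal R}A_{l,r}\Phi_r(n(t))\le c_l\quad\text{for all } l\in\mathcal L .$$ *)

(* Defs.v *)
From HB Require Import structures.
From mathcomp Require Import all_boot all_order all_algebra.
From mathcomp Require Import all_classical all_reals all_analysis.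
Set Implicit Arguments.
Unset Strict Implicit.
Unset Printing Implicit Defensive.
Import Order.TTheory GRing.Theory Num.Theory.
Import numFieldNormedType.Exports.
Local Open Scope classical_set_scope.
Local Open Scope ring_scope.

(* The library norm on matrices is the sup norm, hence a separate l1 norm. *)
Definition l1norm (R : realType) (k : nat) (x : 'cV[R]_k) : R :=
  \sum_(i < k) `|x i 0|.

Definition nonneg_vec (R : realType) (k : nat) (x : 'cV[R]_k) : Prop :=
  forall i, 0 <= x i 0.

Definition substochastic (R : realType) (k : nat) (P : 'M[R]_k) : Prop :=
  (forall r s, 0 <= P r s) /\ (forall r, \sum_(s < k) P r s <= 1).

Definition load (R : realType) (nR : nat) (lambda mu : 'cV[R]_nR)
    (P : 'M[R]_nR) : 'cV[R]_nR :=
  diag_mx (\row_r (mu r 0)^-1) *m invmx (1%:M - P^T) *m lambda.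

Definition within_capacity (R : realType) (nL nR : nat) (A : 'M[R]_(nL, nR))
    (c : 'cV[R]_nL) (g : 'cV[R]_nR) : Prop :=
  forall l, (A *m g) l 0 <= c l 0.

(* The polytope Gamma. *)
Definition feasible (R : realType) (nL nR : nat) (A : 'M[R]_(nL, nR))
    (c : 'cV[R]_nL) : set 'cV[R]_nR :=
  [set g | within_capacity A c g /\ nonneg_vec g].

(* Extended-real valued because log 0 must be -oo, whereas ln 0 = 0. *)
Definition pf_objective (R : realType) (nR : nat) (n g : 'cV[R]_nR) : \bar R :=
  (\sum_(r < nR | (0 < n r 0)%R) (n r 0)%:E * lne (g r 0)%:E)%E.

Definition is_pf_allocation (R : realType) (nL nR : nat) (A : 'M[R]_(nL, nR))
    (c : 'cV[R]_nL) (n g : 'cV[R]_nR) : Prop :=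
  [/\ feasible A c g,
      forall g', feasible A c g' -> (pf_objective n g' <= pf_objective n g)%E &
      forall r, n r 0 = 0 -> g r 0 = 0].

(* The map Lambda. If n >= 0, c > 0 and A is a 0-1 matrix without zero
   columns, exactly one g satisfies is_pf_allocation A c n g, so the default
   value 0 of xget plays no role. *)
Definition pf_allocation (R : realType) (nL nR : nat) (A : 'M[R]_(nL, nR))
    (c : 'cV[R]_nL) (n : 'cV[R]_nR) : 'cV[R]_nR :=
  xget 0 [set g | is_pf_allocation A c n g].

(* limsup of Lambda_r(y) as y tends to x within the orthant y >= 0. *)
Definition pf_limsup (R : realType) (nL nR : nat) (A : 'M[R]_(nL, nR))
    (c : 'cV[R]_nL) (r : 'I_nR) (x : 'cV[R]_nR) : \bar R :=
  limf_esup (fun y => (pf_allocation A c y r 0)%:E)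
    (within [set y | nonneg_vec y] x^').

Definition abs_continuous_on (R : realType) (k : nat) (a b : R)
    (f : R -> 'cV[R]_k) : Prop :=
  forall eps : R, 0 < eps -> exists2 delta : R, 0 < delta &
    forall (p : nat) (u v : 'I_p -> R),
      (forall i, [/\ a <= u i, u i <= v i & v i <= b]) ->
      trivIset [set: 'I_p] (fun i => `]u i, v i[%classic) ->
      \sum_(i < p) (v i - u i) < delta ->
      \sum_(i < p) l1norm (f (v i) - f (u i)) < eps.

(* Only the values n(t) for t >= 0 are constrained. On the unbounded interval
   [0, +oo) absolute continuity means absolute continuity on each [0, T]. *)
Definition fluid_solution (R : realType) (nL nR : nat) (A : 'M[R]_(nL, nR))
    (c : 'cV[R]_nL) (lambda mu : 'cV[R]_nR) (P : 'M[R]_nR)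
    (n : R -> 'cV[R]_nR) : Prop :=
  [/\ forall t, 0 <= t -> nonneg_vec (n t),
      forall T, 0 <= T -> abs_continuous_on 0 T n &
      {ae @lebesgue_measure R, forall t : R, 0 <= t ->
        exists Phi : 'cV[R]_nR,
        [/\ nonneg_vec Phi,
            forall r, is_derive t 1 (fun s : R => n s r 0)
              (lambda r 0 - mu r 0 * Phi r 0
               + \sum_(s < nR) P s r * mu s 0 * Phi s 0),
            forall r, 0 < n t r 0 -> Phi r 0 = pf_allocation A c (n t) r 0,
            forall r, n t r 0 = 0 -> ((Phi r 0)%:E <= pf_limsup A c r (n t))%E &
            within_capacity A c Phi]}].

(* Main.v *)
Require Import Defs.
From HB Require Import structures.
From mathcomp Require Import all_boot all_order all_algebra.
From mathcomp Require Import all_classical all_reals all_analysis.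
From mathcomp Require Import ring lra.

(* The Lyapunov function is G(n) = sum_r n_r log(Lambda_r(n) / rho_r). If q is
   the price vector (the Lagrange multipliers) of the allocation Lambda(n) and
   n* = diag(rho) A^T q, then G(n) is the relative entropy of n with respect to
   n*, so n is close to n* as soon as G(n) is small. Along a fluid solution G
   decreases, at a rate that is bounded below as long as G is and n is bounded.

   The workload W = A diag(m) (I - P^T)^-1 n has derivative c - A Phi >= 0, and
   its coordinate l can only grow while q_l = 0. Since W is approximately B q
   with B positive definite, an approximate complementarity problem results,
   which prevents q, and hence n, from oscillating by more than a constant times
   the largest distance |n - n*|. This bounds n and, once G is small, freezes it.

   Differentiability of G is avoided: its decrease follows from lower
   semicontinuity, finiteness of the upper Dini derivates of G(n(t)) everywhere,
   and a bound on these derivates almost everywhere. *)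

Set Implicit Arguments.
Unset Strict Implicit.
Unset Printing Implicit Defensive.
Import Order.TTheory GRing.Theory Num.Theory.
Import numFieldNormedType.Exports.
Local Open Scope classical_set_scope.
Local Open Scope ring_scope.

(** * Null sets and growth *)

(** The function G is homogeneous of degree one and vanishes on the whole cone of states n*, so its
    decrease alone neither bounds n nor selects a limit; both come from the workload. The two
    estimates are circular, since the distance from n to n* is controlled only by G / (2 eta) + 2
    eta |n|; a small eta lets the second term be absorbed. Empty routes are the obstacle throughout:
    Lambda_r vanishes there and may be discontinuous, the prices need not be unique, and Phi_r need
    not be Lambda_r. But n_r is then at a minimum, so its drift vanishes, and lambda_r > 0 forces
    Phi_r > 0; this makes the entropy estimate of the drift available on all routes at once. All
    constants are fixed before the solution is, which makes the time uniform; n(infinity) is merely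
    the state at that time. *)

(** Continuous induction: the supremum of the points up to which [Q] holds satisfies [Q] by the
    limit step and, unless it is [b], is passed by the extension step. It replaces covering
    arguments on the interval. *)
Lemma real_induction (R : realType) (a b : R) (Q : R -> Prop) :
  a <= b -> Q a ->
  (forall t, a <= t -> t < b -> Q t ->
    exists2 t', t < t' & forall s, t < s -> s < t' -> s <= b -> Q s) ->
  (forall t, a < t -> t <= b -> (forall s, a <= s -> s < t -> Q s) -> Q t) ->
  Q b.
Proof.
move=> leab Qa ext lim.
pose S := [set t | a <= t <= b /\ forall s, a <= s -> s <= t -> Q s].
have Sa : S a.
  split; first by rewrite lexx.
  by move=> s as1 sa; rewrite (_ : s = a)//; apply/eqP; rewrite eq_le sa as1.
have hS : has_sup S.
  by split; [exists a | exists b => t [/andP[_ ->]]].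
have am : a <= sup S by exact: (ub_le_sup hS.2 Sa).
have mb : sup S <= b by apply: ge_sup; [exists a | move=> t [/andP[_ ->]]].
have Qlt s : a <= s -> s < sup S -> Q s.
  move=> as1 sm.
  have [t [_ Qt] st] := sup_adherent (eps := sup S - s) (ltac:(lra)) hS.
  by apply: Qt => //; lra.
have Qm : Q (sup S).
  move: am; rewrite le_eqVlt => /orP[/eqP <- //|am].
  exact: lim.
move: mb; rewrite le_eqVlt => /orP[/eqP <- //|mb].
have [t' mt' Qt'] := ext _ am mb Qm.
have : S (Num.min b ((sup S + t') / 2)).
  split.
    rewrite ge_min lexx /= andbT le_min; apply/andP; split; lra.
  move=> s as1; rewrite le_min => /andP[sb st].
  have [sm|sm|-> //] := ltgtP s (sup S); first exact: Qlt.
  by apply: Qt' => //; lra.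
move=> /(ub_le_sup hS.2); rewrite ge_min => /orP[]; lra.
Qed.

Section null_sets.
Context {R : realType}.
Notation mu := (@lebesgue_measure R).

(** The clock is the measure of [U] to the left of [t], where [U] is an open cover of the null set
    of measure below [e]: it runs at unit speed near each point of [U]. *)
Lemma null_set_clock (N : set R) (e : R) : mu.-negligible N -> 0 < e ->
  exists psi : R -> R, [/\ {homo psi : s t / s <= t},
    forall t, 0 <= psi t <= e &
    forall t, N t -> exists2 d, 0 < d & forall s s', t - d < s -> s <= s' ->
      s' < t + d -> s' - s <= psi s' - psi s].
Proof.
move=> [D [mD D0 ND]] e0.
have {}D0 : mu D = 0%E := D0.
have [U [oU DU Ue]] : exists U : set R,
    [/\ open U, D `<=` U & (mu (U `\` D) < e%:E)%E].
  apply: lebesgue_regularity_outer => //.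
  by rewrite -[ltLHS]/(mu D) D0 ltry.
have mU : measurable U by exact: measurable_realfun.open_measurable.
have {}Ue : (mu U < e%:E)%E.
  rewrite -(setDKU DU) measureU//; last first.
    - by rewrite setDE -setIA setICl setI0.
    - exact: measurableD.
  by rewrite -[X in (_ + X)%E]/(mu D) D0 adde0.
pose psi (t : R) := fine (mu (U `&` `]-oo, t[)).
have le_e t : (mu (U `&` `]-oo, t[) <= e%:E)%E.
  apply: le_trans (ltW Ue); apply: le_measure; rewrite ?inE//.
  - exact: measurableI.
have fin t : mu (U `&` `]-oo, t[) \is a fin_num.
  by rewrite ge0_fin_numE// (le_lt_trans (le_e t))// ltry.
have hpsi : {homo psi : s t / s <= t}.
  move=> s t st; rewrite fine_le// le_measure ?inE//; try exact: measurableI.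
  by apply: setIS => x /=; rewrite !in_itv/= => /lt_le_trans; apply.
exists psi; split => //.
  move=> t; rewrite fine_ge0//= -lee_fin fineK//.
move=> t Nt.
have /nbhs_ballP[d /= d0 dU] : nbhs t U by apply: open_nbhs_nbhs; split => //; exact/DU/ND.
exists d => // s s' ts; rewrite le_eqVlt => /orP[/eqP <- _|ss' s't]; first by rewrite !subrr.
rewrite lerBrDr -lee_fin EFinD /psi !fineK//.
rewrite [leRHS](_ : _ = mu ((U `&` `]-oo, s[) `|` `[s, s'[)); last first.
  congr (mu _); apply/seteqP; split => x /=; rewrite !in_itv/=.
    move=> [Ux xs']; have [xs|xs] := ltP x s; first by left.
    by right; rewrite xs'.
  move=> [[Ux xs]|/andP[sx xs']]; first by split => //; lra.
  split => //; apply: dU; rewrite /ball/= ltr_norml; apply/andP; split; lra.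
rewrite measureU//; last 2 first.
- exact: measurableI.
- apply/seteqP; split => x //=; rewrite !in_itv/= => -[[_ xs] /andP[sx _]]; lra.
have E : mu `[s, s'[%classic = (s' - s)%:E.
  by rewrite lebesgue_measure_itv/= lte_fin ss'.
by rewrite -[X in (X + _ <= _)%E]E addeC.
Qed.

(* The supremum of the sums of the clocks of ever smaller open covers. *)
Lemma null_set_steep_clock (N : set R) (e : R) : mu.-negligible N -> 0 < e ->
  exists psi : R -> R, [/\ {homo psi : s t / s <= t},
    forall t, 0 <= psi t <= e &
    forall t K, N t -> exists2 d, 0 < d & forall h, 0 < h -> h < d ->
      K * h <= psi (t + h) - psi t].
Proof.
move=> N0 e0.
have /choice[f fP] : forall j : nat, exists psi : R -> R,
    [/\ {homo psi : s t / s <= t},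
    forall t, 0 <= psi t <= e / 2 ^+ j.+1 &
    forall t, N t -> exists2 d, 0 < d & forall s s', t - d < s -> s <= s' ->
      s' < t + d -> s' - s <= psi s' - psi s].
  by move=> j; apply: null_set_clock => //; rewrite divr_gt0// exprn_gt0.
pose S k t := \sum_(j < k) f j t.
have S0 k t : 0 <= S k t.
  by apply: sumr_ge0 => j _; have [_ /(_ t)/andP[]] := fP j.
have Se k t : S k t <= e - e / 2 ^+ k.
  elim: k => [|k IH]; first by rewrite /S big_ord0 expr0 divr1 subrr.
  rewrite /S big_ord_recr /= -/(S k t).
  have [_ /(_ t)/andP[_ fk] _] := fP k.
  apply: le_trans (lerD IH fk) _.
  by rewrite exprS invfM; lra.
have Se' k t : S k t <= e.
  by apply: le_trans (Se _ _) _; rewrite gerBl divr_ge0// ?exprn_ge0// ltW.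
have Sm k s t : s <= t -> S k s <= S k t.
  by move=> st; apply: ler_sum => j _; have [/(_ s t st)] := fP j.
have Sk k m t : (k <= m)%N -> S k t <= S m t.
  elim: m => [|m IH]; first by rewrite leqn0 => /eqP ->.
  rewrite leq_eqVlt => /orP[/eqP -> //|km]; apply: le_trans (IH km) _.
  rewrite {2}/S big_ord_recr /= -/(S m t) lerDl.
  by have [_ /(_ t)/andP[]] := fP m.
pose V t := range (fun k => S k t).
have hV t : has_sup (V t).
  by split; [exists (S 0 t); exists 0%N | exists e => _ [k _ <-]].
have Vub k t : S k t <= sup (V t) by apply: (ub_le_sup (hV t).2); exists k.
exists (fun t => sup (V t)); split.
- move=> s t st; apply: ge_sup; first exact: (hV s).1.
  by move=> _ [k _ <-]; apply: le_trans (Vub k t); exact: Sm.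
- move=> t; rewrite (le_trans (S0 0%N t) (Vub _ _))/=.
  by apply: ge_sup; [exact: (hV t).1 | move=> _ [k _ <-]].
move=> t K Nt.
have [k Kk] : exists k : nat, K <= k%:R.
  exists (Num.bound `|K|); apply: le_trans (ler_norm _) _.
  by apply: ltW; apply: archi_boundP; apply: normr_ge0.
(* Each of the first [k] clocks has unit speed near [t], so their sum has speed [k] on the smallest
   of the [k] neighbourhoods. *)
have [d d0 dS] : exists2 d, 0 < d & forall h, 0 < h -> h < d ->
    k%:R * h <= S k (t + h) - S k t.
  elim: k {Kk} => [|k [d d0 IH]].
    by exists 1 => // h h0 _; rewrite /S !big_ord0 mul0r subrr.
  have [_ _ /(_ t Nt)[d' d'0 fk]] := fP k.
  exists (Num.min d d'); first by rewrite lt_min d0.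
  move=> h h0; rewrite lt_min => /andP[hd hd'].
  rewrite /S !big_ord_recr /= -/(S k t) -/(S k (t + h)).
  have := IH h h0 hd; have := fk t (t + h) ltac:(lra) ltac:(lra) ltac:(lra).
  by rewrite -natr1 mulrDl mul1r; lra.
exists d => // h h0 hd; apply: le_trans (_ : k%:R * h <= _).
  by rewrite ler_wpM2r// ltW.
(* The summands beyond the first [k] are nondecreasing, so the speed gained by [S k] survives in all
   later partial sums and in their supremum. *)
rewrite lerBrDr -lerBrDl; apply: ge_sup; first exact: (hV t).1.
move=> _ [m _ <-]; rewrite lerBrDl.
apply: le_trans (Vub (maxn k m) (t + h)).
apply: le_trans (lerD (lexx _) (Sk m (maxn k m) t (leq_maxr _ _))) _.
have -> : forall x, S (maxn k m) x = S k x + \sum_(k <= j < maxn k m) f j x.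
  by move=> x; rewrite /S -!(big_mkord xpredT (fun j => f j x)) -big_cat_nat ?leq_maxl.
have -> : forall x, S (maxn k m) x = S k x + \sum_(k <= j < maxn k m) f j x.
  by move=> x; rewrite /S -!(big_mkord xpredT (fun j => f j x)) -big_cat_nat ?leq_maxl.
have := dS h h0 hd.
suff : \sum_(k <= j < maxn k m) f j t <= \sum_(k <= j < maxn k m) f j (t + h) by lra.
by apply: ler_sum => j _; have [/(_ t (t + h)) + _ _] := fP j; apply; lra.
Qed.

Lemma is_derive_approx (f : R -> R) (t v e : R) :
  is_derive t 1 f v -> 0 < e ->
  exists2 d, 0 < d & forall h, `|h| < d -> `|f (t + h) - f t - h * v| <= e * `|h|.
Proof.
move=> [dv dfv] e0.
have /cvgrPdist_le/(_ e e0) := dv.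
rewrite -/(derive f t 1) dfv /= => /nbhs_ballP[d /= d0 dP].
exists d => // h hd; have [->|h0] := eqVneq h 0.
  by rewrite addr0 mul0r subr0 subrr normr0 mulr0.
have := dP h; rewrite /ball/= sub0r normrN => /(_ hd h0).
rewrite -(ler_pM2r (_ : 0 < `|h|)) ?normr_gt0// -normrM distrC.
congr (`|_| <= _); rewrite mulrBl /GRing.scale/= mulr1 (addrC h t) mulrAC mulVf// mul1r.
by rewrite (mulrC v).
Qed.

End null_sets.

Section growth.
Context {R : realType}.
Notation mu := (@lebesgue_measure R).
Implicit Types (f : R -> R) (a b : R).

(** One endpoint joins the exceptional set, so that an almost everywhere condition imposed only away
    from it can be used at every remaining point. *)
Lemma ae_notin (Q : R -> Prop) a : {ae mu, forall t, Q t} ->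
  exists2 N : set R, mu.-negligible N & forall t, ~ N t -> t != a /\ Q t.
Proof.
move=> Q0; exists ((~` [set t | Q t]) `|` [set a]).
  apply: negligibleU => //; exists [set a]; split => //.
  exact: lebesgue_measure_set1.
move=> t /not_orP[/contrapT Qt ta]; split => //; exact/eqP.
Qed.

(* A clock that runs infinitely fast on the exceptional null set absorbs there
   any finite upper Dini derivate. *)
Lemma dini_nonincreasing f a b : a <= b ->
  (forall t, a < t -> t <= b -> forall e, 0 < e ->
    exists2 d, 0 < d & forall s, t - d < s -> s < t -> f t <= f s + e) ->
  (forall t, a <= t -> t < b -> exists K, exists2 d, 0 < d &
    forall h, 0 < h -> h < d -> f (t + h) <= f t + K * h) ->
  {ae mu, forall t, a < t -> t < b -> forall e, 0 < e ->
    exists2 d, 0 < d & forall h, 0 < h -> h < d -> f (t + h) <= f t + e * h} ->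
  f b <= f a.
Proof.
move=> leab lsc fin /(ae_notin a)[N N0 NP].
apply/ler_addgt0Pr => e e0.
have [psi [psi_homo psi_e psi_N]] := null_set_steep_clock N0 (ltac:(lra) : 0 < e / 2).
(* Half of the error [e] pays for the clock, half for the slope [e1]; the summand 1 admits
   [a = b]. *)
pose e1 := e / (2 * (b - a + 1)).
have e10 : 0 < e1 by rewrite divr_gt0//; lra.
have He1 : e1 * (b - a) <= e / 2.
  have -> : e / 2 = e1 * (b - a + 1) by rewrite /e1; field; lra.
  by rewrite ler_wpM2l//; lra.
suff : f b <= f a + e1 * (b - a) + (psi b - psi a).
  have := psi_e a; have := psi_e b; lra.
apply: (@real_induction R a b (fun t => f t <= f a + e1 * (t - a) + (psi t - psi a))) => //.
- by rewrite !subrr mulr0 !addr0.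
- move=> t a_t tb ft.
  have [Nt|/NP[ta ht]] := pselect (N t).
    have [K [d d0 fd]] := fin t a_t tb.
    have [d' d'0 pd] := psi_N t K Nt.
    exists (t + Num.min d d'); first by rewrite ltrDl lt_min d0.
    move=> s ts; rewrite -ltrBlDl lt_min => /andP[sd sd'] _.
    have := fd (s - t) ltac:(lra) sd; have := pd (s - t) ltac:(lra) sd'.
    rewrite (_ : t + (s - t) = s); last lra.
    have : 0 <= e1 * (s - t) by rewrite mulr_ge0//; lra.
    by rewrite !mulrBr; lra.
  have [|d d0 fd] := ht _ tb e1 e10; first by rewrite lt_def ta.
  exists (t + d); first by rewrite ltrDl.
  move=> s ts sd _; have := fd (s - t) ltac:(lra) ltac:(lra).
  rewrite (_ : t + (s - t) = s); last lra.
  by have := psi_homo _ _ (ltW ts); rewrite !mulrBr; lra.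
- move=> t a_t tb ft; apply/ler_addgt0Pr => k k0.
  have [d d0 fd] := lsc t a_t tb k k0.
  have st : Num.max a (t - d) < t by rewrite gt_max a_t/=; lra.
  pose s := (Num.max a (t - d) + t) / 2.
  have : Num.max a (t - d) < s by rewrite /s; lra.
  rewrite gt_max => /andP[as_ ds]; have s_t : s < t by rewrite /s; lra.
  have := fd s ds s_t; have := ft s (ltW as_) s_t; have := psi_homo _ _ (ltW s_t).
  have : 0 <= e1 * (t - s) by rewrite mulr_ge0//; lra.
  by rewrite !mulrBr; lra.
Qed.

(** Only signed sums are bounded, from above. The intervals form an ordered list indexed by [nat],
    which can be extended by one interval on the right. *)
Definition upper_abs_continuous f a b := forall e, 0 < e ->
  exists2 d, 0 < d & forall p (u v : nat -> R),
    (forall i, (i < p)%N -> [/\ a <= u i, u i <= v i & v i <= b]) ->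
    (forall i j, (i < j)%N -> (j < p)%N -> v i <= u j) ->
    \sum_(i < p) (v i - u i) < d -> \sum_(i < p) (f (v i) - f (u i)) < e.

(** Intervals on which the derivative gives no control are collected in a list. The clock keeps
    their total length below [d], so absolute continuity bounds their contribution by [e / 2]; on
    the rest the slope is at most [K + e1]. *)
Lemma abs_continuous_growth f a b K : a <= b -> 0 <= K -> upper_abs_continuous f a b ->
  {ae mu, forall t, a <= t -> t <= b -> exists2 v, is_derive t 1 f v & v <= K} ->
  f b - f a <= K * (b - a).
Proof.
move=> leab K0 fac /(ae_notin b)[N N0 N_deriv].
have NP t : a <= t -> t <= b -> ~ N t -> exists2 v, is_derive t 1 f v & v <= K.
  by move=> a_t tb /N_deriv[_]; apply.
apply/ler_addgt0Pr => e e0.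
have [d d0 fd] := fac (e / 2) (ltac:(lra)).
have [psi [psi_homo psi_e psi_N]] := null_set_clock N0 (ltac:(lra) : 0 < d / 2).
pose e1 := e / (2 * (b - a + 1)).
have e10 : 0 < e1 by rewrite divr_gt0//; lra.
have He1 : e1 * (b - a) <= e / 2.
  have -> : e / 2 = e1 * (b - a + 1) by rewrite /e1; field; lra.
  by rewrite ler_wpM2l//; lra.
pose Q t := exists p (u v : nat -> R), [/\
  forall i, (i < p)%N -> [/\ a <= u i, u i <= v i & v i <= t],
  forall i j, (i < j)%N -> (j < p)%N -> v i <= u j,
  \sum_(i < p) (v i - u i) <= psi t - psi a &
  f t - f a <= (K + e1) * (t - a) + \sum_(i < p) (f (v i) - f (u i))].
suff : Q b.
  move=> [p [u [v [uv uv' pd fb]]]].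
  have := fd p u v uv uv'; have := psi_e a; have := psi_e b.
  move: pd fb; set S1 := \sum_(i < p) (v i - u i); set S2 := \sum_(i < p) _.
  move=> pd fb psib psia H; have := H ltac:(lra).
  by move: fb; rewrite mulrDl; lra.
have step s t : a <= s -> s <= t -> Q s ->
    f t - f s <= (K + e1) * (t - s) \/ t - s <= psi t - psi s -> Q t.
  move=> as_ st [p [u [v [uv uv' pd fb]]]] [fst|pst].
    exists p, u, v; split => //.
    - by move=> i /uv[? ? ?]; split => //; lra.
    - by apply: le_trans pd _; have := psi_homo _ _ st; lra.
    - by move: fb fst; rewrite !mulrBr; lra.
  exists p.+1, (fun i => if (i < p)%N then u i else s),
    (fun i => if (i < p)%N then v i else t).
  have E (g : R -> R) : \sum_(i < p.+1) (g (if (i < p)%N then v i else t) -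
      g (if (i < p)%N then u i else s)) =
      \sum_(i < p) (g (v i) - g (u i)) + (g t - g s).
    by rewrite big_ord_recr/= ltnn; congr (_ + _); apply: eq_bigr => i _; rewrite ltn_ord.
  split.
  - by move=> i _; case: ifPn => [/uv[? ? ?]|_]; split => //; lra.
  - move=> i j ij; rewrite ltnS => jp; rewrite (leq_trans ij jp).
    by case: ifPn => jp'; [exact: uv'|have [] := uv i (leq_trans ij jp)].
  - by rewrite (E id); lra.
  - rewrite E.
    have : 0 <= (K + e1) * (t - s) by rewrite mulr_ge0//; lra.
    by move: fb; rewrite !mulrBr; lra.
apply: (@real_induction R a b Q) => //.
- by exists 0%N, (fun=> 0), (fun=> 0); split => //; rewrite big_ord0 !subrr ?mulr0 ?addr0.
- move=> t a_t tb Qt.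
  have [Nt|/(NP t a_t (ltW tb))[v dv vK]] := pselect (N t); last first.
    have [k k0 fk] := is_derive_approx dv e10.
    exists (t + k); first by rewrite ltrDl.
    move=> s ts sk _; apply: (step t) => //; first exact: ltW.
    left; have := fk (s - t); rewrite gtr0_norm ?subr_gt0// => /(_ (ltac:(lra))).
    rewrite (_ : t + (s - t) = s); last lra.
    rewrite ler_norml => /andP[_].
    have : (s - t) * v <= (s - t) * K by rewrite ler_wpM2l//; lra.
    by lra.
  have [k k0 pk] := psi_N t Nt.
  exists (t + k); first by rewrite ltrDl.
  move=> s ts sk _; apply: (step t) => //; first exact: ltW.
  by right; apply: pk; lra.
- move=> t a_t tb Qs.
  (* No closedness of [Q] is available at a limit point; the derivative or the clock at [t] itself
     handles one last short interval ending at [t]. *)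
  have left_step k : 0 < k -> (forall s, t - k < s -> s < t ->
      f t - f s <= (K + e1) * (t - s) \/ t - s <= psi t - psi s) -> Q t.
    move=> k0 hk.
    have mt : Num.max a (t - k) < t by rewrite gt_max a_t/=; lra.
    pose s := (Num.max a (t - k) + t) / 2.
    have : Num.max a (t - k) < s by rewrite /s; lra.
    rewrite gt_max => /andP[as_ ks]; have s_t : s < t by rewrite /s; lra.
    by apply: (step s); [exact: ltW | exact: ltW | exact/Qs/s_t/ltW | exact: hk].
  have [Nt|/(NP t (ltW a_t) tb)[v dv vK]] := pselect (N t).
    have [k k0 pk] := psi_N t Nt.
    by apply: (left_step k) => // s ks st; right; apply: pk; lra.
  have [k k0 fk] := is_derive_approx dv e10.
  apply: (left_step k) => // s ks st; left.
  have := fk (s - t); rewrite ltr0_norm ?subr_lt0// => /(_ (ltac:(lra))).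
  rewrite (_ : t + (s - t) = s); last lra.
  rewrite ler_norml => /andP[+ _].
  have : (t - s) * v <= (t - s) * K by rewrite ler_wpM2l//; lra.
  by lra.
Qed.

End growth.

(** * Oscillation of complementarity paths *)

Lemma subr_mxE (R : zmodType) m k (x y : 'M[R]_(m, k)) i j :
  (x - y) i j = x i j - y i j.
Proof. by rewrite !mxE. Qed.

Lemma l1norm_ge0 (R : realType) k (x : 'cV[R]_k) : 0 <= l1norm x.
Proof. exact: sumr_ge0. Qed.

Lemma le_l1norm (R : realType) k (x : 'cV[R]_k) l : `|x l 0| <= l1norm x.
Proof. by rewrite /l1norm (bigD1 l)//= lerDl sumr_ge0. Qed.

Lemma ler_l1normD (R : realType) k (x y : 'cV[R]_k) :
  l1norm (x + y) <= l1norm x + l1norm y.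
Proof. by rewrite -big_split; apply: ler_sum => l _; rewrite mxE ler_normD. Qed.

Lemma l1normN (R : realType) k (x : 'cV[R]_k) : l1norm (- x) = l1norm x.
Proof. by apply: eq_bigr => l _; rewrite mxE normrN. Qed.

Lemma l1norm_distC (R : realType) k (x y : 'cV[R]_k) :
  l1norm (x - y) = l1norm (y - x).
Proof. by rewrite -l1normN opprB. Qed.

Lemma ler_l1norm_dist (R : realType) k (x y z : 'cV[R]_k) :
  l1norm (x - z) <= l1norm (x - y) + l1norm (y - z).
Proof. by rewrite -[x - z](subrKA y) ler_l1normD. Qed.

Lemma nonneg_l1norm (R : realType) k (x : 'cV[R]_k) :
  nonneg_vec x -> l1norm x = \sum_(i < k) x i 0.
Proof. by move=> x0; apply: eq_bigr => i _; rewrite ger0_norm. Qed.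

Definition mx_l1norm (R : realType) m k (B : 'M[R]_(m, k)) : R :=
  \sum_(i < m) \sum_(j < k) `|B i j|.

Lemma mx_l1norm_ge0 (R : realType) m k (B : 'M[R]_(m, k)) : 0 <= mx_l1norm B.
Proof. by apply: sumr_ge0 => i _; exact: sumr_ge0. Qed.

Lemma l1norm_mulmx (R : realType) m k (B : 'M[R]_(m, k)) (x : 'cV[R]_k) :
  l1norm (B *m x) <= mx_l1norm B * l1norm x.
Proof.
rewrite mulr_suml; apply: ler_sum => i _; rewrite mxE mulr_suml.
apply: le_trans (ler_norm_sum _ _ _) _; apply: ler_sum => j _.
by rewrite normrM ler_wpM2l// le_l1norm.
Qed.

(** The square is replaced by its tangent [2 * t * y - t ^+ 2], with [t] chosen so that the linear
    term exceeds [c1 * e * l1norm x] by exactly [e * l1norm x]. *)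
Lemma l1norm_quadratic_bound (R : realType) k (x : 'cV[R]_k) (beta c1 c2 e : R) :
  0 < beta -> 0 < e ->
  beta * \sum_(l < k) x l 0 ^+ 2 <= c1 * e * l1norm x + c2 * e ^+ 2 ->
  l1norm x <= (c2 + k%:R * (c1 + 1) ^+ 2 / (4 * beta)) * e.
Proof.
move=> b0 e0 hx; pose t := e * (c1 + 1) / (2 * beta).
have ht : 2 * t * l1norm x - k%:R * t ^+ 2 <= \sum_(l < k) x l 0 ^+ 2.
  rewrite lerBlDr mulr_sumr (_ : k%:R * t ^+ 2 = \sum_(l < k) t ^+ 2); last first.
    by rewrite sumr_const card_ord mulr_natl.
  rewrite -big_split/=; apply: ler_sum => l _.
  by rewrite -[x l 0 ^+ 2]real_normK ?num_real//; have := sqr_ge0 (`|x l 0| - t); lra.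
have : beta * (2 * t * l1norm x - k%:R * t ^+ 2) <= c1 * e * l1norm x + c2 * e ^+ 2.
  by apply: le_trans hx; rewrite ler_pM2l.
have -> : beta * (2 * t * l1norm x - k%:R * t ^+ 2) = e * ((c1 + 1) * l1norm x -
    k%:R * (c1 + 1) ^+ 2 / (4 * beta) * e) by rewrite /t; field; lra.
have -> : c1 * e * l1norm x + c2 * e ^+ 2 = e * (c1 * l1norm x + c2 * e) by ring.
by rewrite ler_pM2l//; lra.
Qed.

Section oscillation.
Context {R : realType} (k : nat) (B : 'M[R]_k) (beta : R).
Hypothesis beta_gt0 : 0 < beta.
Hypothesis B_coercive : forall x : 'cV[R]_k,
  beta * \sum_(l < k) x l 0 ^+ 2 <= \sum_(l < k) x l 0 * (B *m x) l 0.

(** A perturbed Skorokhod problem without driving term: [W] acts as the regulator of the reflected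
    path [q]. Complementarity is stated on intervals, so [W] needs no derivative, and [q] is not
    assumed continuous. The step [h] of the last field does not enter the oscillation constant. *)
Record complementarity_path (q W : R -> 'cV[R]_k) (a b e : R) : Prop := {
  path_ge0 : forall t, a <= t -> t <= b -> nonneg_vec (q t);
  path_approx : forall t, a <= t -> t <= b ->
    forall l, `|W t l 0 - (B *m q t) l 0| <= e;
  path_homo : forall s t, a <= s -> s <= t -> t <= b ->
    forall l, W s l 0 <= W t l 0;
  path_complementary : forall s t l, a <= s -> s <= t -> t <= b ->
    (forall u, s <= u -> u <= t -> 0 < q u l 0) -> W t l 0 = W s l 0;
  path_ucontinuous : exists2 h, 0 < h & forall s t l, a <= s -> s <= t -> t <= b ->
    t - s < h -> W t l 0 - W s l 0 <= e }.

Lemma complementarity_path_sub q W a b e a' b' :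
  complementarity_path q W a b e -> a <= a' -> b' <= b ->
  complementarity_path q W a' b' e.
Proof.
move=> [q0 qW Wm Wc [h h0 Wh]] aa bb; split.
- by move=> t ? ?; apply: q0; lra.
- by move=> t ? ?; apply: qW; lra.
- by move=> s t ? ? ?; apply: Wm; lra.
- by move=> s t l ? ? ?; apply: Wc; lra.
- by exists h => // s t l ? ? ?; apply: Wh; lra.
Qed.

Lemma complementarity_path_approx q W a b e l :
  complementarity_path q W a b e -> a <= b ->
  `|(W b l 0 - W a l 0) - (B *m (q b - q a)) l 0| <= 2 * e.
Proof.
move=> qW ab.
have -> : (B *m (q b - q a)) l 0 = (B *m q b) l 0 - (B *m q a) l 0.
  by rewrite mulmxBr subr_mxE.
have := path_approx qW ab (lexx b) l; have := path_approx qW (lexx a) ab l.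
by rewrite !ler_norml; lra.
Qed.

(** Coercivity is tested on the increment [x] of [q]. Up to [2 * e], [B *m x] is the increment of
    [W]; by hypothesis its product with [x] costs [c * e] times that increment, which is itself
    linear in [l1norm x]. A square is thus bounded by linear terms. *)
Lemma complementarity_path_increment q W a b e c :
  complementarity_path q W a b e -> a <= b -> 0 < e -> 0 <= c ->
  (forall l, (q b l 0 - q a l 0) * (W b l 0 - W a l 0) <= c * e * (W b l 0 - W a l 0)) ->
  l1norm (q b - q a) <=
    (2 * k%:R * c + k%:R * (2 + k%:R * c * mx_l1norm B + 1) ^+ 2 / (4 * beta)) * e.
Proof.
move=> qW ab e0 c0 hc; apply: l1norm_quadratic_bound => //.
apply: le_trans (B_coercive _) _.
set x := q b - q a.
have BW l : `|(W b l 0 - W a l 0) - (B *m x) l 0| <= 2 * e.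
  exact: complementarity_path_approx.
have Bx l : `|(B *m x) l 0| <= mx_l1norm B * l1norm x.
  exact: le_trans (le_l1norm _ l) (l1norm_mulmx _ _).
have -> : (2 + k%:R * c * mx_l1norm B) * e * l1norm x + 2 * k%:R * c * e ^+ 2 =
    \sum_(l < k) (c * e * (mx_l1norm B * l1norm x + 2 * e) + 2 * e * `|x l 0|).
  by rewrite big_split/= sumr_const card_ord -mulr_sumr -/(l1norm x) -[X in _ = X + _]mulr_natl; ring.
apply: ler_sum => l _.
have hW : W b l 0 - W a l 0 <= mx_l1norm B * l1norm x + 2 * e.
  by have := BW l; have := Bx l; rewrite !ler_norml; lra.
have h1 : x l 0 * ((B *m x) l 0 - (W b l 0 - W a l 0)) <= 2 * e * `|x l 0|.
  apply: le_trans (ler_norm _) _; rewrite normrM mulrC ler_wpM2r//.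
  by rewrite distrC.
have h2 : x l 0 * (W b l 0 - W a l 0) <= c * e * (mx_l1norm B * l1norm x + 2 * e).
  rewrite subr_mxE; apply: le_trans (hc l) _.
  by apply: ler_wpM2l hW; rewrite mulr_ge0// ltW.
by move: h1; rewrite mulrBr; lra.
Qed.

(* Induction on the number of coordinates that may vanish: after the last zero
   of a coordinate one coordinate fewer can vanish, so each coordinate with a
   zero is still small at the end. *)
Lemma complementarity_path_oscillation : exists2 C, 0 <= C &
  forall q W a b e, a <= b -> 0 < e -> complementarity_path q W a b e ->
    l1norm (q b - q a) <= C * e.
Proof.
suff H m : exists2 C, 0 <= C & forall (Z : {set 'I_k}) q W a b e, (#|Z| <= m)%N ->
    a <= b -> 0 < e -> complementarity_path q W a b e ->
    (forall l u, l \notin Z -> a <= u -> u <= b -> 0 < q u l 0) ->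
    l1norm (q b - q a) <= C * e.
  have [C C0 HC] := H k; exists C => // q W a b e ab e0 qW.
  by apply: (HC [set: 'I_k]%SET q W) => //; [rewrite cardsT card_ord | move=> l u; rewrite inE].
pose D c := 2 * k%:R * c + k%:R * (2 + k%:R * c * mx_l1norm B + 1) ^+ 2 / (4 * beta).
have kb0 x : 0 <= k%:R * x ^+ 2 / (4 * beta).
  by rewrite divr_ge0//; [rewrite mulr_ge0 ?sqr_ge0 ?ler0n|rewrite mulr_ge0// ltW].
have D0 c : 0 <= c -> 0 <= D c by move=> c0; rewrite addr_ge0// !mulr_ge0.
have nohit q W a b e l : a <= b -> complementarity_path q W a b e ->
    (forall u, a <= u -> u <= b -> 0 < q u l 0) -> W b l 0 - W a l 0 = 0.
  by move=> ab qW ql; apply/eqP; rewrite subr_eq0; apply/eqP/(path_complementary qW).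
elim: m => [|m [C C0 IH]].
  exists (D 0); first exact: D0.
  move=> Z q W a b e; rewrite leqn0 cards_eq0 => /eqP -> ab e0 qW qZ.
  apply: (complementarity_path_increment qW) => // l.
  rewrite (nohit _ _ _ _ _ _ ab qW) ?mulr0// => u; apply: qZ.
  by rewrite inE.
pose K := C + k%:R * (3 + 1) ^+ 2 / (4 * beta).
have K0 : 0 <= K by rewrite addr_ge0.
exists (D K); first exact: D0.
move=> Z q W a b e Zm ab e0 qW qZ.
apply: (complementarity_path_increment qW) => // l.
have [ql|] := pselect (forall u, a <= u -> u <= b -> 0 < q u l 0).
  by rewrite (nohit _ _ _ _ _ _ ab qW ql) !mulr0.
move=> /existsNP[z /not_implyP[az /not_implyP[zb /negP]]]; rewrite -leNgt => qz.
have Zl : l \in Z by apply/negPn/negP => /qZ/(_ az zb); rewrite ltNge qz.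
apply: ler_wpM2r; first by rewrite subr_ge0 (path_homo qW).
suff : q b l 0 <= K * e by have := path_ge0 qW (lexx a) ab l; lra.
have [h h0 Wh] := path_ucontinuous qW.
pose S := [set u | [/\ a <= u, u <= b & q u l 0 <= 0]].
have hS : has_sup S by split; [exists z | exists b => u []].
have [u [au ub qu] Su] := sup_adherent (ltac:(lra) : 0 < h / 2) hS.
have uS : u <= sup S by apply: (ub_le_sup hS.2).
(* Since [q] may jump, a last zero of coordinate [l] need not exist: [u] is a zero within [h / 2] of
   their supremum. The factor 3/4 puts [w] beyond that supremum, yet less than [h] after [u]. *)
pose w := Num.min b (u + 3 / 4 * h).
have uw : u <= w by rewrite le_min ub/=; lra.
have wb : w <= b by rewrite ge_min lexx.
have wh : w - u < h by have : w <= u + 3 / 4 * h by [rewrite ge_min lexx orbT]; lra.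
(* On this short interval [W] moves by at most [e], hence each coordinate of [B *m (q w - q u)] is
   at most [3 * e]. *)
have qwu : l1norm (q w - q u) <= k%:R * (3 + 1) ^+ 2 / (4 * beta) * e.
  rewrite -[k%:R * _ / _]add0r; apply: l1norm_quadratic_bound => //.
  rewrite mul0r addr0; apply: le_trans (B_coercive _) _.
  rewrite mulr_sumr; apply: ler_sum => j _.
  apply: le_trans (ler_norm _) _; rewrite normrM mulrC ler_wpM2r//.
  have quw := complementarity_path_sub qW au wb.
  have := complementarity_path_approx j quw uw.
  have := Wh u w j au uw wb wh; have := path_homo qW au uw wb j.
  by rewrite !ler_norml; lra.
have := le_l1norm (q w - q u) l; rewrite subr_mxE ler_norml => /andP[_ hwu].
suff : q b l 0 - q w l 0 <= C * e by rewrite /K mulrDl; lra.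
have [->|wneb] := eqVneq w b; first by rewrite subrr mulr_ge0// ltW.
have {wneb} w_b : w < b by rewrite lt_neqAle wneb.
have w_e : w = u + 3 / 4 * h.
  apply/min_idPr; rewrite leNgt; apply/negP => /ltW/min_idPl bw.
  by move: w_b; rewrite /w bw ltxx.
have Sw : sup S < w by rewrite w_e; lra.
have := le_l1norm (q b - q w) l; rewrite subr_mxE ler_norml => /andP[_ hbw].
apply: le_trans hbw _; apply: (IH (Z :\ l) q W) => //.
- by move: Zm; rewrite (cardsD1 l) Zl.
- by apply: (complementarity_path_sub qW) => //; lra.
- move=> j v; rewrite !inE negb_and negbK => /orP[/eqP -> wv vb|jZ wv vb].
    rewrite ltNge; apply/negP => qv.
    have : v <= sup S by apply: (ub_le_sup hS.2); split => //; lra.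
    by lra.
  by apply: qZ => //; lra.
Qed.

End oscillation.

(** * Proportional fairness and its optimality conditions *)

Lemma ln_le_subr1 (R : realType) (x : R) : 0 < x -> ln x <= x - 1.
Proof. by move=> x0; have := expR_ge1Dx (ln x); rewrite lnK ?posrE//; lra. Qed.

Lemma mulr_ln_le (R : realType) (a b : R) : 0 < a -> 0 < b ->
  a * (ln b - ln a) <= b - a.
Proof.
move=> a0 b0; rewrite -ln_div ?posrE//.
have := ln_le_subr1 (divr_gt0 b0 a0); rewrite -(ler_pM2l a0) => /le_trans; apply.
by rewrite mulrBr mulr1 mulrCA divff ?gt_eqF// mulr1.
Qed.

Lemma sum_mulmx_tr (R : comRingType) m k (A : 'M[R]_(m, k)) (x : 'cV[R]_k)
    (y : 'cV[R]_m) :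
  \sum_r x r 0 * (A^T *m y) r 0 = \sum_l (A *m x) l 0 * y l 0.
Proof.
under eq_bigr do rewrite mxE mulr_sumr.
rewrite exchange_big; apply: eq_bigr => l _ /=.
by rewrite mxE mulr_suml; apply: eq_bigr => r _; rewrite mxE; ring.
Qed.

Section kkt.
Context {R : realType} (nL nR : nat) (A : 'M[R]_(nL, nR)) (c : 'cV[R]_nL).
Implicit Types (n g : 'cV[R]_nR) (q : 'cV[R]_nL).

(* The optimality conditions of proportional fairness: q is the vector of
   Lagrange multipliers of the capacity constraints. *)
Record pf_kkt n q g : Prop := {
  kkt_n_ge0 : nonneg_vec n;
  kkt_q_ge0 : nonneg_vec q;
  kkt_g_ge0 : nonneg_vec g;
  kkt_capacity : within_capacity A c g;
  kkt_g0 : forall r, n r 0 = 0 -> g r 0 = 0;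
  kkt_stationary : forall r, g r 0 * (A^T *m q) r 0 = n r 0;
  kkt_total : \sum_l c l 0 * q l 0 = \sum_r n r 0;
  kkt_slack : forall l, 0 < q l 0 -> (A *m g) l 0 = c l 0 }.

Hypothesis A01 : forall l r, A l r = 0 \/ A l r = 1.
Hypothesis A_col_neq0 : forall r, col r A != 0.

Lemma A_ge0 l r : 0 <= A l r.
Proof. by case: (A01 l r) => ->. Qed.

Lemma tr_mulmx_ge0 q r : nonneg_vec q -> 0 <= (A^T *m q) r 0.
Proof.
by move=> q0; rewrite mxE sumr_ge0// => l _; rewrite mxE mulr_ge0// A_ge0.
Qed.

Lemma route_uses_link r : exists l, A l r = 1.
Proof.
apply: contrapT => noA; have /negP := A_col_neq0 r; apply; apply/eqP/matrixP => l j.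
by rewrite !mxE; case: (A01 l r) => // Alr; exfalso; apply: noA; exists l.
Qed.

Lemma tr_mulmx_const_ge x r : 0 <= x -> x <= (A^T *m (const_mx x : 'cV_nL)) r 0.
Proof.
move=> x0; have [l Al] := route_uses_link r.
rewrite mxE (bigD1 l)//= !mxE Al mul1r lerDl sumr_ge0// => j _.
by rewrite !mxE mulr_ge0// A_ge0.
Qed.

Lemma feasible_le g r : feasible A c g -> exists l, g r 0 <= c l 0.
Proof.
move=> [gc g0]; have [l Al] := route_uses_link r; exists l.
apply: le_trans (gc l); rewrite mxE (bigD1 r)//= Al mul1r lerDl sumr_ge0// => j _.
by apply: mulr_ge0; [exact: A_ge0|exact: g0].
Qed.

Lemma kkt_gt0 n q g r : pf_kkt n q g -> 0 < n r 0 -> 0 < g r 0 /\ 0 < (A^T *m q) r 0.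
Proof.
move=> K; rewrite -(kkt_stationary K) => gv.
have g0 := kkt_g_ge0 K r; have v0 := tr_mulmx_ge0 r (kkt_q_ge0 K).
by split; rewrite lt_neqAle ?g0 ?v0 andbT; apply/eqP => E; move: gv;
  rewrite -E ?mul0r ?mulr0 ltxx.
Qed.

Lemma kkt_price_ge0 n q g r : pf_kkt n q g -> 0 <= (A^T *m q) r 0.
Proof. by move=> K; apply/tr_mulmx_ge0/(kkt_q_ge0 K). Qed.

Lemma sum_kkt_le n q g g' : pf_kkt n q g -> within_capacity A c g' ->
  \sum_r g' r 0 * (A^T *m q) r 0 <= \sum_r n r 0.
Proof.
move=> K g'c; rewrite sum_mulmx_tr -(kkt_total K); apply: ler_sum => l _.
by apply: ler_wpM2r; [exact: (kkt_q_ge0 K)|exact: g'c].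
Qed.

(** The allocation is a separate argument, so that competing allocations can be inserted for the
    same state. *)
Definition pf_gap (rho n g : 'cV[R]_nR) : R :=
  \sum_r n r 0 * (ln (g r 0) - ln (rho r 0)).

(** Weak duality: the inequality [mulr_ln_le] is multiplied by the route price, and the total cost
    of [g'] at these prices is at most the total of [n]. *)
Lemma pf_gap_primal (rho : 'cV[R]_nR) n q g g' : pf_kkt n q g -> feasible A c g' ->
  (forall r, 0 < n r 0 -> 0 < g' r 0) -> pf_gap rho n g' <= pf_gap rho n g.
Proof.
move=> K [g'c g'0] g'n.
rewrite -subr_ge0 -sumrB; apply: le_trans (_ : \sum_r (n r 0 - g' r 0 * (A^T *m q) r 0) <= _).
  by rewrite sumrB subr_ge0; exact: (sum_kkt_le K g'c).
apply: ler_sum => r _.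
have := kkt_n_ge0 K r; rewrite le_eqVlt => /orP[/eqP <-|nr].
  by rewrite !mul0r subrr sub0r oppr_le0 mulr_ge0 ?(kkt_price_ge0 _ K).
have [g0 v0] := kkt_gt0 K nr.
have H := mulr_ln_le g0 (g'n r nr); rewrite -(ler_pM2l v0) in H.
have E := kkt_stationary K r.
by move: H; rewrite -E; lra.
Qed.

Lemma pf_gap_ge0 (rho : 'cV[R]_nR) n q g : pf_kkt n q g -> feasible A c rho ->
  (forall r, 0 < rho r 0) -> 0 <= pf_gap rho n g.
Proof.
move=> K rhoc rho0; apply: le_trans (pf_gap_primal rho K rhoc (fun r _ => rho0 r)).
by rewrite sumr_ge0// => r _; rewrite subrr mulr0.
Qed.

(** The right-hand side is the Lagrangian dual function at the trial prices [q']. It does not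
    contain the allocation, so states can be compared without any continuity of the allocation. *)
Lemma pf_gap_dual (rho : 'cV[R]_nR) n q g q' : pf_kkt n q g -> nonneg_vec q' ->
  (forall r, 0 < n r 0 -> 0 < (A^T *m q') r 0) ->
  pf_gap rho n g <= \sum_r (n r 0 * (ln (n r 0) - ln (rho r 0) - ln ((A^T *m q') r 0))
    - n r 0) + \sum_l c l 0 * q' l 0.
Proof.
move=> K q'0 q'n.
have : \sum_r g r 0 * (A^T *m q') r 0 <= \sum_l c l 0 * q' l 0.
  by rewrite sum_mulmx_tr; apply: ler_sum => l _; apply: ler_wpM2r; [exact: q'0|exact: (kkt_capacity K)].
suff : pf_gap rho n g <= \sum_r (n r 0 * (ln (n r 0) - ln (rho r 0) - ln ((A^T *m q') r 0))
    - n r 0) + \sum_r g r 0 * (A^T *m q') r 0 by lra.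
rewrite -big_split/=; apply: ler_sum => r _.
have := kkt_n_ge0 K r; rewrite le_eqVlt => /orP[/eqP <-|nr].
  by rewrite !mul0r subrr add0r; apply: mulr_ge0; [exact: (kkt_g_ge0 K)|exact: tr_mulmx_ge0].
have [g0 v0] := kkt_gt0 K nr; have v'0 := q'n r nr.
have := mulr_ln_le nr (mulr_gt0 g0 v'0); rewrite lnM ?posrE//; lra.
Qed.

(* Testing the dual problem of n' with the multipliers of n, shifted by del,
   gives a one-sided Taylor expansion without logarithms of small numbers. *)
Lemma pf_gap_increment (rho : 'cV[R]_nR) n q g n' q' g' (del : R) :
  (forall r, 0 < rho r 0) -> pf_kkt n q g -> pf_kkt n' q' g' -> 0 < del ->
  pf_gap rho n' g' <= pf_gap rho n g + \sum_r
    (if 0 < n r 0 then (n' r 0 - n r 0) * (ln (g r 0) - ln (rho r 0)) +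
       (n' r 0 - n r 0) ^+ 2 / n r 0
     else n' r 0 ^+ 2 / (rho r 0 * del)) + del * \sum_l c l 0.
Proof.
move=> rho0 K K' del0.
(* Every route uses a link, so each route price becomes at least [del], also at empty routes, whose
   price under [q] may be zero. *)
pose q1 := q + const_mx del.
have v1 r : (A^T *m q) r 0 + del <= (A^T *m q1) r 0.
  by rewrite mulmxDr [leRHS]mxE lerD2l tr_mulmx_const_ge// ltW.
have v1_gt0 r : 0 < (A^T *m q1) r 0.
  by apply: lt_le_trans (v1 r); have := kkt_price_ge0 r K; lra.
have q1_ge0 : nonneg_vec q1.
  by move=> l; rewrite !mxE; have := kkt_q_ge0 K l; lra.
apply: le_trans (pf_gap_dual rho K' q1_ge0 (fun r _ => v1_gt0 r)) _.
have -> : \sum_l c l 0 * q1 l 0 = \sum_r n r 0 + del * \sum_l c l 0.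
  rewrite -(kkt_total K) mulr_sumr -big_split/=; apply: eq_bigr => l _.
  by rewrite !mxE; ring.
rewrite [leLHS]addrA lerD2r -!big_split/=; apply: ler_sum => r _.
have n'0 := kkt_n_ge0 K' r; have := kkt_n_ge0 K r.
rewrite le_eqVlt => /orP[/eqP <-|nr].
  rewrite ltxx mul0r add0r addr0.
  have rd : 0 < rho r 0 * del by rewrite mulr_gt0.
  move: n'0; rewrite le_eqVlt => /orP[/eqP <-|n'r].
    by rewrite mul0r subrr expr0n/= mul0r.
  have hv : ln del <= ln ((A^T *m q1) r 0).
    rewrite ler_ln ?posrE//; apply: le_trans (v1 r).
    by rewrite lerDr (kkt_price_ge0 _ K).
  have := ln_le_subr1 (divr_gt0 n'r rd); rewrite ln_div ?posrE// lnM ?posrE// => H.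
  have : n' r 0 * (ln (n' r 0) - ln (rho r 0) - ln ((A^T *m q1) r 0)) <=
      n' r 0 * (n' r 0 / (rho r 0 * del) - 1) by rewrite ler_pM2l//; lra.
  by rewrite expr2 -mulrA; lra.
rewrite nr.
have [g0 v0] := kkt_gt0 K nr.
have lnv : ln (n r 0) - ln (g r 0) <= ln ((A^T *m q1) r 0).
  rewrite -(kkt_stationary K r) lnM ?posrE// [X in X - _]addrC addrK ler_ln ?posrE//.
  by apply: le_trans (v1 r); rewrite lerDl ltW.
have sq : (n' r 0 - n r 0) ^+ 2 / n r 0 = n' r 0 * (n' r 0 / n r 0) - 2 * n' r 0 + n r 0.
  by field; rewrite gt_eqF.
move: n'0; rewrite le_eqVlt => /orP[/eqP E|n'r].
  by rewrite sq -E; lra.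
have := ln_le_subr1 (divr_gt0 n'r nr); rewrite ln_div ?posrE// => H.
have : n' r 0 * (ln (n' r 0) - ln (rho r 0) - ln ((A^T *m q1) r 0)) <=
    n' r 0 * (n' r 0 / n r 0 - 1 + ln (g r 0) - ln (rho r 0)) by rewrite ler_pM2l//; lra.
by rewrite sq; lra.
Qed.

End kkt.

(** * Continuity of products of powers, and inequalities for the logarithm *)

Lemma continuous_norm_powR (R : realType) (p : R) : 0 < p ->
  continuous (fun x : R => `|x| `^ p).
Proof.
move=> p0 x; have [->|x0] := eqVneq x 0.
  apply/cvgrPdist_lt => e e0; rewrite normr0 powR0 ?gt_eqF//.
  near=> y; rewrite sub0r normrN ger0_norm ?powR_ge0//.
  have <- : (e `^ p^-1) `^ p = e.
    by rewrite -powRrM mulVf ?gt_eqF// powRr1// ltW.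
  apply: gt0_ltr_powR => //; rewrite ?nnegrE ?powR_ge0//.
  near: y; apply/nbhs_ballP; exists (e `^ p^-1); first exact: powR_gt0.
  by move=> y; rewrite /ball/= sub0r normrN.
apply: (@continuous_comp _ _ _ (fun x : R => `|x|) (fun x => x `^ p)).
  exact: norm_continuous.
apply: differentiable_continuous; apply/derivable1_diffP; apply: derivable_powR.
by rewrite in_itv/= andbT normr_gt0.
Unshelve. all: by end_near. Qed.
Lemma continuous_prod_seq (R : realType) (T : topologicalType) (I : Type) (s : seq I) (Q : pred I)
  (f : I -> T -> R) : (forall i, Q i -> continuous (f i)) ->
  continuous (fun x => \prod_(i <- s | Q i) f i x).
Proof.
move=> cf; elim: s => [|i s IH].
  rewrite (_ : (fun x => _) = fun=> 1); first exact: cst_continuous.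
  by apply/funext => x; rewrite big_nil.
rewrite (_ : (fun x => _) = fun x => (if Q i then f i x else 1) *
    \prod_(j <- s | Q j) f j x); last first.
  by apply/funext => x; rewrite big_cons; case: ifP; rewrite ?mul1r.
by move=> x; apply: cvgM (IH x); case: ifP => [/cf|_]; [exact|exact: cvg_cst].
Qed.
Lemma continuous_sum_seq (R : realType) (T : topologicalType) (I : Type)
    (s : seq I) (f : I -> T -> R) : (forall i, continuous (f i)) ->
  continuous (fun x => \sum_(i <- s) f i x).
Proof.
move=> cf; elim: s => [|i s IH].
  rewrite (_ : (fun x => _) = fun=> 0); first exact: cst_continuous.
  by apply/funext => x; rewrite big_nil.
rewrite (_ : (fun x => _) = fun x => f i x + \sum_(j <- s) f j x); last first.
  by apply/funext => x; rewrite big_cons.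
by move=> x; apply: cvgD (cf i x) (IH x).
Qed.

Lemma continuous_rV_mulmx (R : realType) m k (A : 'M[R]_(m, k)) r :
  continuous (fun p : 'rV[R]_m => (p *m A) 0 r).
Proof.
rewrite (_ : (fun p => _) = fun p : 'rV[R]_m => \sum_l p 0 l * A l r); last first.
  by apply/funext => p; rewrite mxE.
apply: continuous_sum_seq => l x.
apply: (@continuousM _ _ (fun p : 'rV[R]_m => p 0 l) (cst (A l r))).
  exact: coord_continuous.
exact: cst_continuous.
Qed.

Lemma exp_sum_ln (R : realType) (I : finType) (Q : pred I) (w x : I -> R) :
  (forall i, Q i -> 0 < x i) ->
  \prod_(i | Q i) `|x i| `^ w i = expR (\sum_(i | Q i) w i * ln (x i)).
Proof.
move=> x0; rewrite expR_sum; apply: eq_bigr => i /x0 xi.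
by rewrite gtr0_norm// /powR gt_eqF.
Qed.

Lemma eq_mulr_ln (R : realType) (a b : R) : 0 < a -> 0 < b ->
  b - a <= a * (ln b - ln a) -> b = a.
Proof.
move=> a0 b0 h; have [lnab|ne] := eqVneq (ln b - ln a) 0.
  by apply: ln_inj; rewrite ?posrE//; lra.
have := expR_gt1Dx ne; rewrite expRB !lnK ?posrE// ltr_pdivlMr//; lra.
Qed.

(** A Pinsker inequality in linear form: [|s - t| * (s + t)] with square roots [s], [t] is split by
    the arithmetic-geometric mean inequality with weight [eta]. *)
Lemma dist_le_kl (R : realType) (a b eta : R) : 0 <= a -> 0 <= b -> 0 < eta ->
  (0 < a -> 0 < b) ->
  `|a - b| <= (a * (ln a - ln b) - a + b) / (2 * eta) + eta * (a + b).
Proof.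
move=> a0 b0 eta0 ab.
have [s s0 Ea] : exists2 s, 0 <= s & a = s ^+ 2.
  by exists (Num.sqrt a); rewrite ?sqrtr_ge0 ?sqr_sqrtr.
have [t t0 Eb] : exists2 t, 0 <= t & b = t ^+ 2.
  by exists (Num.sqrt b); rewrite ?sqrtr_ge0 ?sqr_sqrtr.
have -> : `|a - b| = `|s - t| * (s + t).
  by rewrite Ea Eb subr_sqr normrM (ger0_norm (addr_ge0 s0 t0)).
(* The squared Hellinger distance bounds the relative entropy from below. *)
have kl : (s - t) ^+ 2 <= a * (ln a - ln b) - a + b.
  move: (a0); rewrite le_eqVlt => /orP[/eqP a_0|a_gt0].
    have -> : s = 0 by apply/eqP; rewrite -(sqrf_eq0 s) -Ea -a_0.
    by rewrite -a_0 Eb; lra.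
  have b_gt0 := ab a_gt0.
  have s_gt0 : 0 < s by rewrite lt_def s0 andbT -(sqrf_eq0 s) -Ea gt_eqF.
  have t_gt0 : 0 < t by rewrite lt_def t0 andbT -(sqrf_eq0 t) -Eb gt_eqF.
  have := mulr_ln_le s_gt0 t_gt0; rewrite -(ler_pM2l s_gt0).
  by rewrite Ea Eb !lnXn// !mulr2n !expr2; lra.
have sq : 0 <= (`|s - t| - eta * (s + t)) ^+ 2 by exact: sqr_ge0.
have sq' : (s + t) ^+ 2 <= 2 * (a + b).
  by rewrite Ea Eb; have := sqr_ge0 (s - t); lra.
have eta2 : 0 < 2 * eta by lra.
rewrite -(ler_pM2r eta2) [leRHS]mulrDl [X in _ <= X + _]divfK ?gt_eqF//.
apply: le_trans (lerD kl (lexx _)).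
have E : `|s - t| ^+ 2 = (s - t) ^+ 2 by rewrite real_normK ?num_real.
have : eta ^+ 2 * (s + t) ^+ 2 <= eta ^+ 2 * (2 * (a + b)) by rewrite ler_wpM2l ?sqr_ge0.
by rewrite -E; lra.
Qed.

(** * Existence of prices and uniqueness of the allocation *)

Section allocation.
Context {R : realType} (nL nR : nat) (A : 'M[R]_(nL, nR)) (c : 'cV[R]_nL).
Hypothesis A01 : forall l r, A l r = 0 \/ A l r = 1.
Hypothesis A_col_neq0 : forall r, col r A != 0.
Hypothesis c_gt0 : forall l, 0 < c l 0.
Implicit Types (n g : 'cV[R]_nR) (q : 'cV[R]_nL).

(** With [N] the total of the state, the normalization is [kkt_total] imposed in advance; it makes
    the set of prices compact. *)
Definition price_simplex (N : R) : set 'rV[R]_nL :=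
  [set p : 'rV[R]_nL | (forall l, 0 <= p 0 l) /\ (p *m c) 0 0 = N].

Lemma compact_price_simplex N : compact (price_simplex N).
Proof.
apply: (@subclosed_compact _ _
    [set p : 'rV[R]_nL | forall l, `[0, N / c l 0]%classic (p ord0 l)]).
- have -> : price_simplex N = (\bigcap_(l in [set: 'I_nL])
      ((fun p : 'rV[R]_nL => p 0 l) @^-1` [set x | 0 <= x])) `&`
      ((fun p : 'rV[R]_nL => (p *m c) 0 0) @^-1` [set x | x = N]).
    apply/seteqP; split => p [p0 pN]; split => //; first by move=> l _; exact: p0.
    by move=> l; exact: (p0 l I).
  apply: closedI.
    apply: closed_bigI => l _; apply: preimage_closed (@closed_ge _ 0).
    by move=> p _; apply: coord_continuous.
  apply: preimage_closed (@closed_eq _ N).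
  by move=> p _; exact: continuous_rV_mulmx.
- apply: (@rV_compact _ _ (fun l => `[0, N / c l 0]%classic)) => l.
  exact: segment_compact.
- move=> p [p0 pN] l /=; rewrite in_itv/= p0/= ler_pdivlMr// -pN mxE (bigD1 l)//=.
  by rewrite lerDl sumr_ge0// => j _; rewrite mulr_ge0// ltW.
Qed.

Lemma price_tr (p : 'rV[R]_nL) r : (A^T *m p^T) r 0 = (p *m A) 0 r.
Proof. by rewrite -trmx_mul mxE. Qed.

(* Nash social welfare of the prices; its maximizers satisfy the optimality
   conditions. Norms make it continuous outside the simplex too. *)
Definition price_welfare n (p : 'rV[R]_nL) : R :=
  \prod_(r | 0 < n r 0) `|(p *m A) 0 r| `^ n r 0.

Lemma price_welfare_max n N : 0 < N -> 0 < \sum_r n r 0 ->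
  exists p, [/\ price_simplex N p, 0 < price_welfare n p &
    forall p', price_simplex N p' -> price_welfare n p' <= price_welfare n p].
Proof.
move=> N0 n0.
have [l0 _] : exists l : 'I_nL, True.
  case: (pickP (fun r : 'I_nR => true)) => [r _|nR0].
    by have [l _] := route_uses_link A01 A_col_neq0 r; exists l.
  by move: n0; rewrite big1 ?ltxx// => r; have := nR0 r.
(* Equal prices on all links give every route a positive price, so the maximal welfare is
   positive. *)
have c0 : 0 < \sum_l c l 0.
  by rewrite (bigD1 l0)//= ltr_wpDr// sumr_ge0// => l _; exact: ltW.
pose d := N / \sum_l c l 0; have d0 : 0 < d by rewrite divr_gt0.
have dK : price_simplex N (const_mx d).
  split; first by move=> l; rewrite mxE ltW.
  rewrite mxE; under eq_bigr do rewrite mxE.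
  by rewrite -mulr_sumr /d divfK// gt_eqF.
have K0 : price_simplex N !=set0 by exists (const_mx d).
have cf : {within price_simplex N, continuous (price_welfare n)}.
  apply: continuous_subspaceT; apply: continuous_prod_seq => r nr x.
  apply: (@continuous_comp _ _ _ (fun p : 'rV[R]_nL => (p *m A) 0 r)
    (fun y : R => `|y| `^ n r 0)).
    exact: continuous_rV_mulmx.
  exact: continuous_norm_powR.
have [p] := compact_EVT_max K0 (@compact_price_simplex N) cf.
move=> /set_mem pK pmax.
exists p; split => //; last by move=> p' /mem_set; exact: pmax.
apply: lt_le_trans (pmax _ (mem_set dK)).
apply: prodr_gt0 => r nr; apply: powR_gt0; rewrite normr_gt0 gt_eqF//.
rewrite -price_tr.
have -> : (const_mx d : 'rV[R]_nL)^T = const_mx d by apply/matrixP => i j; rewrite !mxE.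
by apply: lt_le_trans (tr_mulmx_const_ge A01 A_col_neq0 r (ltW d0)).
Qed.

(** First-order optimality on the segment from [p] to [p']: the logarithm of the welfare grows by at
    least [th * S1 - 2 * th ^+ 2 * S2], so the directional derivative [S1] cannot be positive. The
    bound [th <= 1 / 2] keeps route prices above half of their value at [p]. *)
Lemma price_welfare_stationary n N p p' : nonneg_vec n -> price_simplex N p ->
  price_simplex N p' -> 0 < price_welfare n p ->
  (forall p', price_simplex N p' -> price_welfare n p' <= price_welfare n p) ->
  \sum_r n r 0 / (A^T *m p^T) r 0 * (A^T *m p'^T) r 0 <= \sum_r n r 0.
Proof.
move=> n0 [p0 pN] [p'0 p'N] wp pmax.
pose v r := (A^T *m p^T) r 0; pose v' r := (A^T *m p'^T) r 0.
have v_ge0 r : 0 <= v r by apply: tr_mulmx_ge0 => // l; rewrite mxE.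
have v'_ge0 r : 0 <= v' r by apply: tr_mulmx_ge0 => // l; rewrite mxE.
have v_gt0 r : 0 < n r 0 -> 0 < v r.
  move=> nr; rewrite lt_def v_ge0 andbT; apply/eqP => vr.
  move: wp; rewrite /price_welfare (bigD1 r)//= -price_tr -/(v r) vr normr0.
  by rewrite powR0 ?gt_eqF// mul0r ltxx.
pose S1 := \sum_(r | 0 < n r 0) n r 0 * (v' r - v r) / v r.
pose S2 := \sum_(r | 0 < n r 0) n r 0 * (v' r - v r) ^+ 2 / v r ^+ 2.
have S2_ge0 : 0 <= S2 by apply: sumr_ge0 => r nr; rewrite divr_ge0 ?sqr_ge0// mulr_ge0 ?sqr_ge0// ltW.
have S12 th : 0 < th -> th <= 1 / 2 -> S1 <= 2 * th * S2.
  move=> th0 th1.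
  pose pt := p + th *: (p' - p).
  pose vt r := v r + th * (v' r - v r).
  have vtE r : (A^T *m pt^T) r 0 = vt r.
    rewrite /pt linearD linearZ linearB/= mulmxDr -scalemxAr mulmxBr.
    by rewrite [LHS]mxE [X in _ + X]mxE subr_mxE.
  have vt_gt r : v r / 2 <= vt r.
    have -> : vt r = (1 - th) * v r + th * v' r by rewrite /vt; ring.
    have := mulr_ge0 (ltW th0) (v'_ge0 r).
    have : v r / 2 <= (1 - th) * v r by rewrite mulrC ler_wpM2r//; lra.
    lra.
  have ptK : price_simplex N pt.
    split.
      move=> l; have -> : pt 0 l = (1 - th) * p 0 l + th * p' 0 l.
        by rewrite /pt !mxE; ring.
      by rewrite addr_ge0// mulr_ge0//; lra.
    rewrite /pt mulmxDl -scalemxAl mulmxBl [LHS]mxE [X in _ + X]mxE subr_mxE pN p'N.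
    by rewrite subrr mulr0 addr0.
  have := pmax pt ptK; rewrite /price_welfare.
  under eq_bigr do rewrite -price_tr vtE.
  under [leRHS]eq_bigr do rewrite -price_tr -/(v _).
  rewrite exp_sum_ln; last by move=> r /v_gt0 vr; apply: lt_le_trans (vt_gt r); lra.
  rewrite exp_sum_ln// ler_expR -subr_ge0 -sumrB => H.
  rewrite -(ler_pM2l th0) -subr_ge0; apply: le_trans H _.
  rewrite -subr_ge0 /S1 /S2 !mulr_sumr -!sumrB; apply: sumr_ge0 => r nr.
  have vr := v_gt0 r nr; have vtr : 0 < vt r by apply: lt_le_trans (vt_gt r); lra.
  have h1 : ln (v r) - ln (vt r) <= (v r - vt r) / vt r.
    by rewrite ler_pdivlMr// mulrC mulr_ln_le.
  have h2 : (v r - vt r) / vt r <= 2 * th ^+ 2 * (v' r - v r) ^+ 2 / v r ^+ 2 -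
      th * (v' r - v r) / v r.
    rewrite -subr_ge0.
    have -> : 2 * th ^+ 2 * (v' r - v r) ^+ 2 / v r ^+ 2 - th * (v' r - v r) / v r -
        (v r - vt r) / vt r = th ^+ 2 * (v' r - v r) ^+ 2 * (2 * vt r - v r) / (v r ^+ 2 * vt r).
      by rewrite /vt; field; rewrite -/(vt r) !gt_eqF.
    apply: divr_ge0; apply: mulr_ge0; try exact: sqr_ge0; last exact: ltW.
      by apply: mulr_ge0; exact: sqr_ge0.
    by have := vt_gt r; lra.
  have := ler_wpM2l (ltW nr) (le_trans h1 h2).
  by lra.
have S1_le0 : S1 <= 0.
  rewrite leNgt; apply/negP => S1_gt0.
  pose th := Num.min (1 / 2) (S1 / (4 * (S2 + 1))).
  have th0 : 0 < th by rewrite lt_min; apply/andP; split; [lra|apply: divr_gt0 => //; lra].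
  have := S12 th th0; rewrite ge_min lexx => /(_ isT).
  have : th * (4 * (S2 + 1)) <= S1.
    by rewrite -ler_pdivlMr ?ge_min ?lexx ?orbT//; lra.
  have := mulr_ge0 (ltW th0) S2_ge0; lra.
rewrite -subr_le0 -sumrB; apply: le_trans S1_le0.
rewrite /S1 [leRHS]big_mkcond/=; apply: ler_sum => r _.
have [nr|nr] := ltP 0 (n r 0).
  have := v_gt0 r nr => vr; rewrite le_eqVlt; apply/orP; left; apply/eqP.
  by rewrite -/(v r) -/(v' r); field; rewrite gt_eqF.
have -> : n r 0 = 0 by apply/eqP; rewrite eq_le nr n0.
by rewrite !mul0r subrr.
Qed.

(** The allocation is [n] divided by the route prices of a welfare maximizer. Stationarity towards
    the vertex of the simplex at link [l] is the capacity constraint of [l]; equality of the totals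
    then gives slackness. *)
Lemma kkt_exists n : nonneg_vec n -> exists q g, pf_kkt A c n q g.
Proof.
move=> n0; pose N := \sum_r n r 0.
have : 0 <= N by exact: sumr_ge0.
rewrite le_eqVlt => /orP[/eqP N0|N_gt0].
  have nr r : n r 0 = 0.
    by apply: (psumr_eq0P (P := xpredT) (F := fun r => n r 0)) => // i _; exact: n0.
  exists 0, 0; split => //; rewrite ?mulmx0.
  - by move=> l; rewrite mxE.
  - by move=> r; rewrite mxE.
  - by move=> l; rewrite mulmx0 mxE ltW.
  - by move=> r _; rewrite mxE.
  - by move=> r; rewrite mxE mul0r nr.
  - by rewrite -/N -N0 big1// => l _; rewrite mxE mulr0.
  - by move=> l; rewrite mxE ltxx.
have [p [pK wp pmax]] := price_welfare_max N_gt0 N_gt0.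
pose g : 'cV_nR := \col_r (n r 0 / (A^T *m p^T) r 0).
have stat p' : price_simplex N p' -> \sum_l (A *m g) l 0 * p' 0 l <= N.
  move=> p'K; have := price_welfare_stationary n0 pK p'K wp pmax.
  rewrite (eq_bigr (fun r => g r 0 * (A^T *m p'^T) r 0)); last first.
    by move=> r _; rewrite [g r 0]mxE.
  rewrite sum_mulmx_tr => H; apply: le_trans H.
  by apply: ler_sum => l _; rewrite [p'^T _ _]mxE.
have [p0 pN] := pK.
have v_ge0 r : 0 <= (A^T *m p^T) r 0 by apply: tr_mulmx_ge0 => // l; rewrite mxE.
have gv r : g r 0 * (A^T *m p^T) r 0 = n r 0.
  rewrite mxE; have := n0 r; rewrite le_eqVlt => /orP[/eqP <-|nr]; first by rewrite !mul0r.
  rewrite divfK//; apply/eqP => vr.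
  move: wp; rewrite /price_welfare (bigD1 r)//= -price_tr vr normr0.
  by rewrite powR0 ?gt_eqF// mul0r ltxx.
have g0 : nonneg_vec g by move=> r; rewrite mxE divr_ge0.
have gc : within_capacity A c g.
  move=> l; pose p' : 'rV[R]_nL := \row_j (if j == l then N / c l 0 else 0).
  have : price_simplex N p'.
    split; first by move=> j; rewrite mxE; case: ifP => // _; rewrite divr_ge0// ltW.
    rewrite mxE (bigD1 l)//= !mxE eqxx divfK ?gt_eqF// big1 ?addr0// => j /negbTE jl.
    by rewrite mxE jl mul0r.
  move=> /stat; rewrite (bigD1 l)//= big1 => [|j /negbTE jl]; last first.
    by rewrite !mxE jl mulr0.
  by rewrite addr0 [p' _ _]mxE eqxx mulrA ler_pdivrMr// mulrC ler_pM2l.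
have tot : \sum_l c l 0 * p^T l 0 = N.
  by rewrite -pN mxE; apply: eq_bigr => l _; rewrite mxE mulrC.
exists p^T, g; split => //.
- by move=> l; rewrite mxE.
- by move=> r nr; rewrite mxE nr mul0r.
- move=> l pl; apply/eqP; rewrite eq_sym -subr_eq0; apply/eqP.
  have : \sum_l (c l 0 - (A *m g) l 0) * p^T l 0 = 0.
    under eq_bigr do rewrite mulrBl.
    by rewrite sumrB tot -sum_mulmx_tr (eq_bigr _ (fun r _ => gv r)) subrr.
  have nn j : xpredT j -> 0 <= (c j 0 - (A *m g) j 0) * p^T j 0.
    by rewrite mulr_ge0 ?subr_ge0 ?gc// mxE.
  move=> /(psumr_eq0P nn)/(_ l isT)/eqP.
  by rewrite mulf_eq0 (gt_eqF pl) orbF => /eqP.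
Qed.

Lemma pf_objective_EFin n g : (forall r, 0 < n r 0 -> 0 < g r 0) ->
  pf_objective n g = (\sum_(r | 0 < n r 0) n r 0 * ln (g r 0))%:E.
Proof.
move=> g0; rewrite /pf_objective -sumEFin; apply: eq_bigr => r /g0 gr.
by rewrite lne_EFin.
Qed.

Lemma pf_objective_Ny n g r : 0 < n r 0 -> g r 0 <= 0 -> pf_objective n g = -oo%E.
Proof.
move=> nr gr; rewrite /pf_objective (bigD1 r)//= gr.
by rewrite gt0_muleNy ?lte_fin// addNye.
Qed.

Lemma pf_gapE (rho : 'cV[R]_nR) n g : nonneg_vec n ->
  pf_gap rho n g = \sum_(r | 0 < n r 0) n r 0 * ln (g r 0) -
    \sum_(r | 0 < n r 0) n r 0 * ln (rho r 0).
Proof.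
move=> n0; rewrite -sumrB [RHS]big_mkcond; apply: eq_bigr => r _; rewrite -mulrBr.
case: ltP => // nr; have -> : n r 0 = 0 by apply/eqP; rewrite eq_le nr n0.
by rewrite mul0r.
Qed.

Lemma kkt_is_pf_allocation n q g : pf_kkt A c n q g -> is_pf_allocation A c n g.
Proof.
move=> K; have gn r : 0 < n r 0 -> 0 < g r 0 by move=> /(kkt_gt0 A01 K)[].
split; [by split; [exact: kkt_capacity K|exact: kkt_g_ge0 K]| |exact: kkt_g0 K].
move=> g' g'f; have [g'n|] := pselect (forall r, 0 < n r 0 -> 0 < g' r 0).
  rewrite !pf_objective_EFin// lee_fin.
  have := pf_gap_primal A01 g K g'f g'n.
  by rewrite !pf_gapE ?lerD2r//; exact: kkt_n_ge0 K.
move=> /existsNP[r /not_implyP[nr /negP]]; rewrite -leNgt => g'r.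
by rewrite (pf_objective_Ny nr g'r) leNye.
Qed.

(** Each [term] is an inequality, while optimality and capacity give the reverse one for the sums;
    hence every term is an equality, and the equality case [eq_mulr_ln] identifies the
    allocations. *)
Lemma kkt_pf_unique n q g g' : pf_kkt A c n q g -> is_pf_allocation A c n g' ->
  g' = g.
Proof.
move=> K [g'f g'max g'0].
have [gf _ _] := kkt_is_pf_allocation K.
have gn r : 0 < n r 0 -> 0 < g r 0 by move=> /(kkt_gt0 A01 K)[].
have g'n r : 0 < n r 0 -> 0 < g' r 0.
  move=> nr; rewrite ltNge; apply/negP => g'r.
  by have := g'max g gf; rewrite (pf_objective_Ny nr g'r) pf_objective_EFin.
have := g'max g gf; rewrite !pf_objective_EFin// lee_fin -subr_ge0.
rewrite -(pf_gapE _ _ (kkt_n_ge0 K)) => H0.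
have H1 := sum_kkt_le K g'f.1.
have term r : n r 0 * (ln (g' r 0) - ln (g r 0)) <= g' r 0 * (A^T *m q) r 0 - n r 0.
  have := kkt_n_ge0 K r; rewrite le_eqVlt => /orP[/eqP <-|nr].
    by rewrite !mul0r subr0 mulr_ge0 ?(kkt_price_ge0 A01 _ K)// g'f.2.
  have [gr vr] := kkt_gt0 A01 K nr.
  have H := mulr_ln_le gr (g'n r nr); rewrite -(ler_pM2l vr) in H.
  by move: H; rewrite -(kkt_stationary K r); lra.
apply/matrixP => r j; rewrite ord1.
have := kkt_n_ge0 K r; rewrite le_eqVlt => /orP[/eqP nr|nr].
  by rewrite g'0// (kkt_g0 K).
have [gr vr] := kkt_gt0 A01 K nr.
apply: eq_mulr_ln => //; first exact: g'n.
rewrite -(ler_pM2l vr).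
have H2 : \sum_(i | i != r) n i 0 * (ln (g' i 0) - ln (g i 0)) <=
    \sum_(i | i != r) (g' i 0 * (A^T *m q) i 0 - n i 0).
  by apply: ler_sum => i _; exact: term.
rewrite -subr_le0 -sumrB (bigD1 r)//= in H1.
rewrite /pf_gap (bigD1 r)//= in H0; move: H0 H1 H2.
set S := \sum_(i | i != r) _; set S' := \sum_(i | i != r) _.
by rewrite -(kkt_stationary K r); lra.
Qed.

Lemma kkt_pf_allocation n q g : pf_kkt A c n q g -> pf_allocation A c n = g.
Proof.
move=> K; apply: xget_unique; first exact: kkt_is_pf_allocation K.
by move=> g'; exact: kkt_pf_unique K.
Qed.

End allocation.

(** * Traffic equations and workload *)

(** The added 1 covers an empty index type, on which no minimum exists. *)
Lemma pos_lower_bound (R : realFieldType) (I : finType) (f : I -> R) :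
  (forall i, 0 < f i) -> exists2 m, 0 < m & forall i, m <= f i.
Proof.
move=> f0.
have S0 : 0 < 1 + \sum_i (f i)^-1.
  by rewrite ltr_pwDl// sumr_ge0// => i _; rewrite invr_ge0 ltW.
exists (1 + \sum_i (f i)^-1)^-1; first by rewrite invr_gt0.
move=> i; rewrite -[f i]invrK lef_pV2 ?posrE ?invr_gt0// (bigD1 i)//=.
have : 0 <= \sum_(j | j != i) (f j)^-1 by apply: sumr_ge0 => j _; rewrite invr_ge0 ltW.
lra.
Qed.

Lemma sum_sqr_le_l1norm (R : realType) k (x : 'cV[R]_k) :
  \sum_(l < k) x l 0 ^+ 2 <= l1norm x ^+ 2.
Proof.
rewrite expr2 [X in _ <= X * _]/l1norm mulr_suml; apply: ler_sum => l _.
rewrite -[x l 0 ^+ 2]real_normK ?num_real// expr2.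
by apply: ler_wpM2l => //; exact: le_l1norm.
Qed.

Lemma sqr_l1norm_le (R : realType) k (x : 'cV[R]_k) :
  l1norm x ^+ 2 <= k%:R * \sum_(l < k) x l 0 ^+ 2.
Proof.
have E : \sum_(l < k) \sum_(j < k) `|x l 0| * `|x j 0| = l1norm x ^+ 2.
  by rewrite expr2 {1}/l1norm mulr_suml; apply: eq_bigr => l _; rewrite -mulr_sumr.
have E1 : \sum_(l < k) \sum_(j < k) x l 0 ^+ 2 = k%:R * \sum_(l < k) x l 0 ^+ 2.
  by rewrite mulr_sumr; apply: eq_bigr => l _; rewrite sumr_const card_ord mulr_natl.
have E2 : \sum_(l < k) \sum_(j < k) x j 0 ^+ 2 = k%:R * \sum_(l < k) x l 0 ^+ 2.
  by rewrite exchange_big.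
have : \sum_(l < k) \sum_(j < k) 2 * (`|x l 0| * `|x j 0|) <=
    \sum_(l < k) \sum_(j < k) (x l 0 ^+ 2 + x j 0 ^+ 2).
  apply: ler_sum => l _; apply: ler_sum => j _.
  rewrite -[x l 0 ^+ 2]real_normK ?num_real// -[x j 0 ^+ 2]real_normK ?num_real//.
  by have := sqr_ge0 (`|x l 0| - `|x j 0|); lra.
under eq_bigr do rewrite -mulr_sumr; rewrite -mulr_sumr E.
under [leRHS]eq_bigr do rewrite big_split; rewrite big_split/= E1 E2; lra.
Qed.

Section traffic.
Context {R : realType} (nR : nat) (lambda mu : 'cV[R]_nR) (P : 'M[R]_nR).
Hypothesis mu_gt0 : forall r, 0 < mu r 0.
Hypothesis P_substochastic : substochastic P.
Hypothesis IPT_unit : 1%:M - P^T \in unitmx.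
Hypothesis lambda_gt0 : forall r, 0 < lambda r 0.

(* Total arrival rates, the solution of the traffic equations. *)
Definition traffic : 'cV[R]_nR := invmx (1%:M - P^T) *m lambda.

Lemma mulmx_IPT (z : 'cV[R]_nR) r :
  ((1%:M - P^T) *m z) r 0 = z r 0 - \sum_s P s r * z s 0.
Proof.
rewrite mulmxBl mul1mx subr_mxE [X in _ - X]mxE; congr (_ - _).
by apply: eq_bigr => s _; rewrite mxE.
Qed.

Lemma traffic_equation r :
  traffic r 0 = lambda r 0 + \sum_s P s r * traffic s 0.
Proof.
have := mulmx_IPT traffic r; rewrite /traffic mulmxA mulmxV// mul1mx -/traffic; lra.
Qed.

Lemma traffic_ge0 r : 0 <= traffic r 0.
Proof.
(* Sum the traffic equations over the routes with negative total rate. *)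
have [P0 P1] := P_substochastic.
have sumN : \sum_(r | traffic r 0 < 0) lambda r 0 <= 0.
  suff : \sum_(r | traffic r 0 < 0) (lambda r 0 - traffic r 0) <=
      - \sum_(s | traffic s 0 < 0) traffic s 0 by rewrite sumrB; lra.
  apply: le_trans (_ : \sum_(r | traffic r 0 < 0) \sum_(s | traffic s 0 < 0)
      P s r * - traffic s 0 <= _).
    apply: ler_sum => r' _; rewrite {1}traffic_equation opprD addrA subrr sub0r.
    rewrite -sumrN (bigID (fun s => traffic s 0 < 0))/=.
    rewrite -[leRHS]addr0; apply: lerD.
      by apply: ler_sum => s _; rewrite mulrN.
    by apply: sumr_le0 => s; rewrite -leNgt => s0; rewrite oppr_le0 mulr_ge0.
  rewrite exchange_big -sumrN; apply: ler_sum => s s0 /=.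
  rewrite -mulr_suml ler_piMl//; first by rewrite oppr_ge0 ltW.
  apply: le_trans (P1 s); rewrite [leRHS](bigID (fun r => traffic r 0 < 0))/= lerDl.
  exact: sumr_ge0.
rewrite leNgt; apply/negP => r0; move: sumN; apply/negP; rewrite -ltNge.
by rewrite (bigD1 r)//= ltr_pwDl// sumr_ge0// => s _; exact: ltW.
Qed.

Lemma traffic_gt0 r : 0 < traffic r 0.
Proof.
rewrite traffic_equation ltr_pwDl// sumr_ge0// => s _.
by rewrite mulr_ge0 ?traffic_ge0//; have [] := P_substochastic.
Qed.

Lemma loadE r : load lambda mu P r 0 = traffic r 0 / mu r 0.
Proof. by rewrite /load -mulmxA mul_diag_mx !mxE mulrC. Qed.

Lemma load_gt0 r : 0 < load lambda mu P r 0.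
Proof. by rewrite loadE divr_gt0// traffic_gt0. Qed.

(** Here [x] stands for the ratios of service rates to loads. The tangent inequality
    [x_s ln x_r <= x_s ln x_s + x_r - x_s] decouples the routing terms; the traffic equations sum
    them over the sources, substochasticity over the targets. Only the external arrivals leave a
    deficit. *)
Lemma traffic_dissipation (x : 'cV[R]_nR) : (forall r, 0 < x r 0) ->
  \sum_r ln (x r 0) * (lambda r 0 - traffic r 0 * x r 0 +
      \sum_s P s r * (traffic s 0 * x s 0)) <=
  - \sum_r lambda r 0 * (x r 0 - 1 - ln (x r 0)).
Proof.
move=> x0; have [P0 P1] := P_substochastic.
pose a r := traffic r 0; pose y r := x r 0.
have a0 r : 0 < a r by exact: traffic_gt0.
have h1 : \sum_r ln (y r) * (\sum_s P s r * (a s * y s)) <=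
    \sum_r \sum_s P s r * a s * (y s * ln (y s) + y r - y s).
  apply: ler_sum => r _; rewrite mulr_sumr; apply: ler_sum => s _.
  have := mulr_ln_le (x0 s) (x0 r); rewrite -/(y s) -/(y r).
  move=> h.
  have : P s r * a s * (y s * (ln (y r) - ln (y s))) <= P s r * a s * (y r - y s).
    by rewrite ler_wpM2l ?mulr_ge0 ?(ltW (a0 s))//; lra.
  by lra.
have sumP (f : 'I_nR -> R) : \sum_r \sum_s P s r * a s * f r = \sum_r (a r - lambda r 0) * f r.
  apply: eq_bigr => r _; rewrite -mulr_suml {2}/a traffic_equation -/a; congr (_ * _).
  by rewrite addrAC subrr add0r.
have h2 : \sum_r \sum_s P s r * a s * (y s * ln (y s) + y r - y s) <=
    \sum_r (a r * (y r * ln (y r) - y r + 1) + (a r - lambda r 0) * (y r - 1)).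
  (* The summand 1 is inserted because [y ln y - y + 1] is nonnegative, as needed where row sums of
     [P] are merely at most 1. *)
  have -> : \sum_r \sum_s P s r * a s * (y s * ln (y s) + y r - y s) =
      \sum_r \sum_s P s r * a s * (y s * ln (y s) - y s + 1) +
      \sum_r \sum_s P s r * a s * (y r - 1).
    rewrite -big_split; apply: eq_bigr => r _; rewrite -big_split; apply: eq_bigr => s _ /=.
    by ring.
  rewrite sumP [leRHS]big_split/= lerD2r exchange_big; apply: ler_sum => s _ /=.
  rewrite -mulr_suml -mulr_suml -mulrA ler_piMl//.
  rewrite mulr_ge0 ?(ltW (a0 s))//; have := mulr_ln_le (x0 s) (@ltr01 R).
  by rewrite ln1 -/(y s); lra.
have -> : \sum_r ln (x r 0) * (lambda r 0 - traffic r 0 * x r 0 +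
      \sum_s P s r * (traffic s 0 * x s 0)) =
    \sum_r ln (y r) * (lambda r 0 - a r * y r) +
    \sum_r ln (y r) * (\sum_s P s r * (a s * y s)).
  by rewrite -big_split; apply: eq_bigr => r _; rewrite mulrDr.
apply: le_trans (lerD (lexx _) (le_trans h1 h2)) _.
rewrite -big_split/= -sumrN; apply: ler_sum => r _; rewrite -/(y r).
by lra.
Qed.

(* Expected remaining service requirement on each link, per job on each route. *)
Definition workload_mx nL (A : 'M[R]_(nL, nR)) : 'M[R]_(nL, nR) :=
  A *m diag_mx (\row_r (mu r 0)^-1) *m invmx (1%:M - P^T).

(** The drift is [lambda] minus [1%:M - P^T] applied to the departure rates [w], so the inverse in
    the workload cancels internal transfers. *)
Lemma workload_drift nL (A : 'M[R]_(nL, nR)) (Phi v : 'cV[R]_nR) :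
  (forall r, v r 0 = lambda r 0 - mu r 0 * Phi r 0 +
    \sum_s P s r * mu s 0 * Phi s 0) ->
  workload_mx A *m v = A *m load lambda mu P - A *m Phi.
Proof.
move=> vE; pose w : 'cV[R]_nR := \col_r (mu r 0 * Phi r 0).
have -> : v = lambda - (1%:M - P^T) *m w.
  apply/matrixP => r j; rewrite ord1 subr_mxE mulmx_IPT vE mxE.
  rewrite [X in _ = _ - (_ - X)](eq_bigr (fun s => P s r * mu s 0 * Phi s 0)); first lra.
  by move=> s _; rewrite mxE mulrA.
rewrite mulmxBr /workload_mx -!mulmxA mulKmx// /load -!mulmxA; congr (_ - _ *m _).
by apply/matrixP => r j; rewrite ord1 mul_diag_mx !mxE mulKf// gt_eqF.
Qed.

(** Sends prices to the workload of the state that has these prices when the allocation is the load.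
    It need not be symmetric. *)
Definition workload_price_mx nL (A : 'M[R]_(nL, nR)) : 'M[R]_nL :=
  workload_mx A *m diag_mx (load lambda mu P)^T *m A^T.

(** In the variables [u] the form is the sum of [traffic_r u_r ^+ 2] minus that of
    [P_sr traffic_s u_s u_r]. Splitting the products into squares and using the traffic equations
    leaves at least half of the sum of [lambda_r u_r ^+ 2]. *)
Lemma workload_price_coercive nL (A : 'M[R]_(nL, nR)) : row_free A ->
  exists2 beta, 0 < beta & forall x : 'cV[R]_nL,
    beta * \sum_l x l 0 ^+ 2 <= \sum_l x l 0 * (workload_price_mx A *m x) l 0.
Proof.
move=> /row_freeP[A' AA']; have [P0 P1] := P_substochastic.
have [lam0 lam0_gt0 lam0_le] := pos_lower_bound lambda_gt0.
(* [F] recovers [x] from [u]: it undoes the scalings and the inverse, and [A'^T] is a left inverse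
   of [A^T] because [A] has full row rank. *)
pose F : 'M[R]_(nL, nR) := A'^T *m diag_mx (\row_r (load lambda mu P r 0)^-1) *m
  (1%:M - P^T) *m diag_mx traffic^T.
pose Q := mx_l1norm F ^+ 2 * nR%:R.
have Q0 : 0 <= Q by rewrite mulr_ge0 ?sqr_ge0.
exists (lam0 / (2 * (Q + 1))); first by rewrite divr_gt0// mulr_gt0//; lra.
move=> x.
pose y := diag_mx (load lambda mu P)^T *m (A^T *m x).
pose z := invmx (1%:M - P^T) *m y.
pose u : 'cV[R]_nR := \col_r (z r 0 / traffic r 0).
have zE r : z r 0 = traffic r 0 * u r 0.
  by rewrite [u r 0]mxE mulrC divfK// gt_eqF// traffic_gt0.
have yE r : y r 0 = traffic r 0 * u r 0 - \sum_s P s r * (traffic s 0 * u s 0).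
  have -> : y = (1%:M - P^T) *m z by rewrite /z mulKVmx.
  by rewrite mulmx_IPT zE; congr (_ - _); apply: eq_bigr => s _; rewrite zE.
have xE : x = F *m u.
  have -> : F *m u = A'^T *m (diag_mx (\row_r (load lambda mu P r 0)^-1) *m y).
    rewrite /F -!mulmxA; congr (_ *m (_ *m _)).
    rewrite -[RHS](mulKVmx IPT_unit); congr (_ *m _); apply/matrixP => r j.
    by rewrite ord1 mul_diag_mx [LHS]mxE [X in X * _]mxE -zE.
  have -> : diag_mx (\row_r (load lambda mu P r 0)^-1) *m y = A^T *m x.
    apply/matrixP => r j; rewrite mul_diag_mx [LHS]mxE [X in X * _]mxE.
    rewrite /y mul_diag_mx [X in _ * X]mxE [X in _ * (X * _)]mxE.
    by rewrite mulKf// gt_eqF// load_gt0.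
  by rewrite mulmxA -trmx_mul AA' trmx1 mul1mx.
have form : \sum_l x l 0 * (workload_price_mx A *m x) l 0 = \sum_r y r 0 * u r 0.
  rewrite /workload_price_mx /workload_mx -!mulmxA -/y -/z.
  under eq_bigr do rewrite mulrC; rewrite -sum_mulmx_tr; apply: eq_bigr => r _.
  rewrite mul_diag_mx [X in X * _]mxE [X in X * _ * _]mxE zE.
  rewrite /y mul_diag_mx [X in _ = X * _]mxE [X in _ = X * _ * _]mxE loadE.
  by ring.
have lower : \sum_r lambda r 0 * u r 0 ^+ 2 <= 2 * \sum_r y r 0 * u r 0.
  have PE : \sum_r y r 0 * u r 0 = \sum_r traffic r 0 * u r 0 ^+ 2 -
      \sum_r \sum_s P s r * traffic s 0 * (u s 0 * u r 0).
    rewrite -sumrB; apply: eq_bigr => r _; rewrite yE mulrBl mulr_suml.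
    by congr (_ - _); [ring|apply: eq_bigr => s _; ring].
  have h1 : \sum_r \sum_s P s r * traffic s 0 * (u s 0 * u r 0) <=
      \sum_r \sum_s (P s r * (traffic s 0 * u s 0 ^+ 2 / 2) +
        P s r * traffic s 0 * (u r 0 ^+ 2 / 2)).
    apply: ler_sum => r _; apply: ler_sum => s _.
    have := mulr_ge0 (mulr_ge0 (P0 s r) (traffic_ge0 s)) (sqr_ge0 (u s 0 - u r 0)).
    by lra.
  have h2 : \sum_r \sum_s P s r * (traffic s 0 * u s 0 ^+ 2 / 2) <=
      \sum_s traffic s 0 * u s 0 ^+ 2 / 2.
    rewrite exchange_big; apply: ler_sum => s _; rewrite -mulr_suml ler_piMl//.
    by rewrite divr_ge0// mulr_ge0 ?sqr_ge0 ?traffic_ge0.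
  have h3 : \sum_r \sum_s P s r * traffic s 0 * (u r 0 ^+ 2 / 2) =
      \sum_r (traffic r 0 - lambda r 0) * (u r 0 ^+ 2 / 2).
    apply: eq_bigr => r _; rewrite -mulr_suml; congr (_ * _).
    by rewrite [X in X - _]traffic_equation addrAC subrr add0r.
  have h4 : \sum_r \sum_s (P s r * (traffic s 0 * u s 0 ^+ 2 / 2) +
        P s r * traffic s 0 * (u r 0 ^+ 2 / 2)) =
      \sum_r \sum_s P s r * (traffic s 0 * u s 0 ^+ 2 / 2) +
      \sum_r \sum_s P s r * traffic s 0 * (u r 0 ^+ 2 / 2).
    by rewrite -big_split; apply: eq_bigr => r _; rewrite big_split.
  have h5 : \sum_r lambda r 0 * u r 0 ^+ 2 = 2 * (\sum_r traffic r 0 * u r 0 ^+ 2 -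
      \sum_s traffic s 0 * u s 0 ^+ 2 / 2 -
      \sum_r (traffic r 0 - lambda r 0) * (u r 0 ^+ 2 / 2)).
    by rewrite -!sumrB mulr_sumr; apply: eq_bigr => r _; field.
  by rewrite PE h5; lra.
rewrite form mulrAC ler_pdivrMr; last lra.
have hx : \sum_l x l 0 ^+ 2 <= Q * \sum_r u r 0 ^+ 2.
  apply: le_trans (sum_sqr_le_l1norm x) _.
  apply: le_trans (_ : (mx_l1norm F * l1norm u) ^+ 2 <= _).
    by rewrite ler_sqr ?nnegrE ?l1norm_ge0 ?mulr_ge0 ?mx_l1norm_ge0 ?l1norm_ge0// {1}xE l1norm_mulmx.
  by rewrite exprMn /Q -mulrA ler_wpM2l ?sqr_ge0// sqr_l1norm_le.
have hu : lam0 * \sum_r u r 0 ^+ 2 <= 2 * \sum_r y r 0 * u r 0.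
  apply: le_trans lower; rewrite mulr_sumr; apply: ler_sum => r _.
  by rewrite ler_wpM2r ?sqr_ge0.
have yu : 0 <= \sum_r y r 0 * u r 0.
  suff : 0 <= lam0 * \sum_r u r 0 ^+ 2 by lra.
  by rewrite mulr_ge0 ?(ltW lam0_gt0)// sumr_ge0// => r _; exact: sqr_ge0.
apply: le_trans (ler_wpM2l (ltW lam0_gt0) hx) _; rewrite mulrCA.
apply: le_trans (ler_wpM2l Q0 hu) _; lra.
Qed.

End traffic.

(** * The Lyapunov function *)

Section gap.
Context {R : realType} (nL nR : nat) (A : 'M[R]_(nL, nR)) (c : 'cV[R]_nL).
Context (rho : 'cV[R]_nR).
Hypothesis A01 : forall l r, A l r = 0 \/ A l r = 1.
Hypothesis A_col_neq0 : forall r, col r A != 0.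
Hypothesis c_gt0 : forall l, 0 < c l 0.
Hypothesis rho_gt0 : forall r, 0 < rho r 0.
Hypothesis critical : A *m rho = c.
Implicit Types (n g : 'cV[R]_nR) (q : 'cV[R]_nL).

(** With empty routes the prices need not be unique, so this is an arbitrary selection without
    regularity in [n]. *)
Definition pf_price n : 'cV[R]_nL :=
  xget 0 [set q | pf_kkt A c n q (pf_allocation A c n)].

Lemma pf_priceP n : nonneg_vec n ->
  pf_kkt A c n (pf_price n) (pf_allocation A c n).
Proof.
move=> /(kkt_exists A01 A_col_neq0 c_gt0)[q [g K]].
pose S := [set q' | pf_kkt A c n q' (pf_allocation A c n)].
suff : S (xget 0 S) by [].
by apply: xgetPex; exists q; rewrite /S /= (kkt_pf_allocation A01 K).
Qed.

Lemma feasible_rho : feasible A c rho.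
Proof. by split => [l|r]; [rewrite critical|exact: ltW]. Qed.

Definition alloc_gap n : R := pf_gap rho n (pf_allocation A c n).

Lemma alloc_gap_ge0 n : nonneg_vec n -> 0 <= alloc_gap n.
Proof. by move=> /pf_priceP K; exact: (pf_gap_ge0 A01 K feasible_rho rho_gt0). Qed.

Lemma alloc_log_le n r : nonneg_vec n -> 0 < n r 0 ->
  ln (pf_allocation A c n r 0) - ln (rho r 0) <=
  (\sum_l c l 0) * \sum_r (rho r 0)^-1.
Proof.
move=> /pf_priceP K nr; have [g0 _] := kkt_gt0 A01 K nr.
rewrite -ln_div ?posrE//.
apply: le_trans (ln_le_subr1 (divr_gt0 g0 (rho_gt0 r))) _.
apply: le_trans (_ : pf_allocation A c n r 0 / rho r 0 <= _); first lra.
have [l gl] := feasible_le A01 A_col_neq0 r (conj (kkt_capacity K) (kkt_g_ge0 K)).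
apply: ler_pM; first exact: ltW.
- by rewrite invr_ge0 ltW.
- apply: le_trans gl _; rewrite (bigD1 l)//= lerDl sumr_ge0// => j _.
  exact: ltW.
- rewrite (bigD1 r)//= lerDl sumr_ge0// => j _; rewrite invr_ge0.
  exact: ltW.
Qed.

Lemma alloc_gap_le n : nonneg_vec n ->
  alloc_gap n <= (\sum_l c l 0) * (\sum_r (rho r 0)^-1) * l1norm n.
Proof.
move=> n0; rewrite (nonneg_l1norm n0) mulr_sumr; apply: ler_sum => r _.
have := n0 r; rewrite le_eqVlt => /orP[/eqP <-|nr]; first by rewrite mul0r mulr0.
by rewrite mulrC ler_pM2r// alloc_log_le.
Qed.

(* The states that have price vector q and whose allocation is the load rho. *)
Definition invariant_state q : 'cV[R]_nR := diag_mx rho^T *m A^T *m q.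

Lemma invariant_stateE q r : invariant_state q r 0 = rho r 0 * (A^T *m q) r 0.
Proof. by rewrite /invariant_state -mulmxA mul_diag_mx !mxE. Qed.

(** Critical load and [kkt_total] give both states the same total, which turns the gap into a sum of
    nonnegative entropy terms. [eta] stays free, to be taken small against the oscillation
    constant. *)
Lemma dist_invariant_le n eta : nonneg_vec n -> 0 < eta ->
  l1norm (n - invariant_state (pf_price n)) <=
    alloc_gap n / (2 * eta) + 2 * eta * l1norm n.
Proof.
move=> n0 eta0; have K := pf_priceP n0.
set q := pf_price n in K *; set g := pf_allocation A c n in K *.
pose w r := invariant_state q r 0.
have w0 r : 0 <= w r.
  by rewrite /w invariant_stateE mulr_ge0 ?(ltW (rho_gt0 r))// (kkt_price_ge0 A01 _ K).
have sumw : \sum_r w r = \sum_r n r 0.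
  under eq_bigr do rewrite /w invariant_stateE.
  by rewrite sum_mulmx_tr critical (kkt_total K).
have gapE : alloc_gap n = \sum_r (n r 0 * (ln (n r 0) - ln (w r)) - n r 0 + w r).
  rewrite big_split sumrB/= sumw subrK; apply: eq_bigr => r _.
  have := n0 r; rewrite le_eqVlt => /orP[/eqP <-|nr]; first by rewrite !mul0r.
  have [g0 v0] := kkt_gt0 A01 K nr.
  rewrite /w invariant_stateE -/g -(kkt_stationary K r) !lnM ?posrE//; congr (_ * _).
  by ring.
have -> : 2 * eta * l1norm n = \sum_r eta * (n r 0 + w r).
  by rewrite -mulr_sumr big_split/= sumw (nonneg_l1norm n0); ring.
rewrite gapE mulr_suml -big_split/=; apply: ler_sum => r _.
rewrite subr_mxE -/(w r); apply: dist_le_kl => // nr.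
have [_ v0] := kkt_gt0 A01 K nr.
by rewrite /w invariant_stateE mulr_gt0.
Qed.

(** The gap is a supremum of functions linear in the state; one nearly optimal allocation with
    finite logarithms bounds it from below at all nearby states. *)
Lemma alloc_gap_lsc n e : nonneg_vec n -> 0 < e ->
  exists2 d, 0 < d & forall n', nonneg_vec n' -> l1norm (n' - n) < d ->
    alloc_gap n <= alloc_gap n' + e.
Proof.
move=> n0 e0; have K := pf_priceP n0.
set g := pf_allocation A c n in K *.
(* Moving the allocation slightly towards rho makes it positive everywhere. *)
pose N := l1norm n; have N0 : 0 <= N := l1norm_ge0 n.
pose th := Num.min (1 / 2) (e / (4 * (N + 1))).
have th0 : 0 < th by rewrite lt_min; apply/andP; split; [lra|apply: divr_gt0 => //; lra].
have th1 : th <= 1 / 2 by rewrite ge_min lexx.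
have thN : th * (4 * (N + 1)) <= e.
  by rewrite -ler_pdivlMr ?ge_min ?lexx ?orbT//; lra.
pose gt : 'cV[R]_nR := (1 - th) *: g + th *: rho.
have gtE r : gt r 0 = (1 - th) * g r 0 + th * rho r 0 by rewrite !mxE.
have gt0 r : 0 < gt r 0.
  rewrite gtE; have := mulr_gt0 th0 (rho_gt0 r).
  have : 0 <= (1 - th) * g r 0 by rewrite mulr_ge0 ?(kkt_g_ge0 K)//; lra.
  lra.
have gtf : feasible A c gt.
  split; last by move=> r; exact: ltW.
  move=> l; rewrite mulmxDr -!scalemxAr critical !mxE.
  have : (1 - th) * (A *m g) l 0 <= (1 - th) * c l 0.
    by rewrite ler_wpM2l ?(kkt_capacity K)//; lra.
  by rewrite mxE; lra.
pose S := \sum_r `|ln (gt r 0) - ln (rho r 0)|.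
have S0 : 0 <= S by exact: sumr_ge0.
exists (e / (2 * (S + 1))); first by rewrite divr_gt0//; lra.
move=> n' n'0 n'n.
have K' := pf_priceP n'0.
have h1 := pf_gap_primal A01 rho K' gtf (fun r _ => gt0 r).
have h2 : alloc_gap n <= pf_gap rho n gt + 2 * th * N.
  rewrite /N (nonneg_l1norm n0) mulr_sumr -big_split/=; apply: ler_sum => r _.
  have := n0 r; rewrite le_eqVlt => /orP[/eqP <-|nr]; first by rewrite !mul0r mulr0 addr0.
  have [g0 _] := kkt_gt0 A01 K nr.
  have th2 : 0 < 1 - th by lra.
  have : ln (1 - th) + ln (g r 0) <= ln (gt r 0).
    rewrite -lnM ?posrE// ler_ln ?posrE ?mulr_gt0// gtE lerDl.
    by rewrite mulr_ge0 ?ltW.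
  have : - (2 * th) <= ln (1 - th).
    have := mulr_ln_le th2 (@ltr01 R); rewrite ln1 sub0r => h.
    have : (1 - th) * - ln (1 - th) <= (1 - th) * (2 * th) by nra.
    by rewrite ler_pM2l//; lra.
  move=> a1 a2; rewrite -/g.
  have : n r 0 * (ln (g r 0) - ln (rho r 0)) <= n r 0 * (ln (gt r 0) - ln (rho r 0) + 2 * th).
    by rewrite ler_pM2l//; lra.
  by lra.
have h3 : pf_gap rho n gt <= pf_gap rho n' gt + S * l1norm (n' - n).
  rewrite -lerBlDl -sumrB [leRHS]mulrC mulr_sumr; apply: ler_sum => r _.
  rewrite -mulrBl; apply: le_trans (ler_norm _) _; rewrite normrM ler_wpM2r//.
  by rewrite distrC -subr_mxE le_l1norm.
have h4 : S * l1norm (n' - n) <= e / 2.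
  have : l1norm (n' - n) * (2 * (S + 1)) <= e by rewrite -ler_pdivlMr ?ltW//; lra.
  have := l1norm_ge0 (n' - n); lra.
rewrite -/(alloc_gap n') in h1; lra.
Qed.

Context (lambda : 'cV[R]_nR).
Hypothesis lambda_gt0 : forall r, 0 < lambda r 0.

(** Only occupied routes are summed, since the allocation of an empty route is zero by
    convention. *)
Definition dissipation n : R :=
  \sum_(r | 0 < n r 0) lambda r 0 * (pf_allocation A c n r 0 / rho r 0 - 1 -
    (ln (pf_allocation A c n r 0) - ln (rho r 0))).

Lemma dissipation_term_ge0 (x y : R) : 0 < x -> 0 < y -> 0 <= x / y - 1 - (ln x - ln y).
Proof.
by move=> x0 y0; rewrite -ln_div ?posrE// subr_ge0 ln_le_subr1// divr_gt0.
Qed.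

Lemma dissipation_ge0 n : nonneg_vec n -> 0 <= dissipation n.
Proof.
move=> n0; apply: sumr_ge0 => r nr; have [g0 _] := kkt_gt0 A01 (pf_priceP n0) nr.
by rewrite mulr_ge0 ?(ltW (lambda_gt0 r))// dissipation_term_ge0.
Qed.

(** A gap of [e] with mass at most [Bd] forces a log ratio [z] above [y = e / (2 * Bd)] on some
    occupied route, and [expR z - 1 - z >= z ^+ 2 / 4] there, by squaring
    [expR (z / 2) >= 1 + z / 2]. *)
Lemma dissipation_lower_bound Bd e : 0 < Bd -> 0 < e ->
  exists2 del, 0 < del & forall n, nonneg_vec n -> l1norm n <= Bd ->
    e <= alloc_gap n -> del <= dissipation n.
Proof.
move=> Bd0 e0; have [lam0 lam0_gt0 lam0_le] := pos_lower_bound lambda_gt0.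
pose y := e / (2 * Bd); have y0 : 0 < y by rewrite divr_gt0// mulr_gt0.
exists (lam0 * (y ^+ 2 / 4)); first by rewrite mulr_gt0// divr_gt0// exprn_gt0.
move=> n n0 nB en; have K := pf_priceP n0.
set g := pf_allocation A c n in K *.
have [r nr gr] : exists2 r, 0 < n r 0 & y < ln (g r 0) - ln (rho r 0).
  apply: contrapT => no; suff : alloc_gap n <= e / 2 by lra.
  apply: le_trans (_ : y * l1norm n <= _); last first.
    have -> : e / 2 = y * Bd by rewrite /y; field; rewrite gt_eqF.
    by rewrite ler_pM2l.
  rewrite (nonneg_l1norm n0) mulr_sumr; apply: ler_sum => r _.
  have := n0 r; rewrite le_eqVlt => /orP[/eqP <-|nr]; first by rewrite mul0r mulr0.
  rewrite mulrC ler_pM2r// leNgt; apply/negP => yr; apply: no; by exists r.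
have [g0 _] := kkt_gt0 A01 K nr.
rewrite /dissipation (bigD1 r)//= -/g; apply: le_trans (_ : lambda r 0 * (g r 0 / rho r 0 - 1 - (ln (g r 0) - ln (rho r 0))) <= _);
    last first.
  rewrite lerDl sumr_ge0// => i /andP[ni _]; have [gi _] := kkt_gt0 A01 K ni.
  by rewrite mulr_ge0 ?(ltW (lambda_gt0 i))// dissipation_term_ge0.
apply: ler_pM => //; [exact: ltW|by rewrite divr_ge0 ?sqr_ge0|].
rewrite -ln_div ?posrE// in gr *.
have gr0 : 0 < g r 0 / rho r 0 by rewrite divr_gt0.
move: gr; set z := ln _ => yz.
have -> : g r 0 / rho r 0 = expR (z / 2) ^+ 2.
  by rewrite -expRM_natl (_ : 2%:R * (z / 2) = z) ?lnK ?posrE//; field.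
have h1 : 1 + z / 2 <= expR (z / 2) by exact: expR_ge1Dx.
have h2 : (1 + z / 2) ^+ 2 <= expR (z / 2) ^+ 2 by rewrite ler_sqr ?nnegrE//; lra.
have h3 : y ^+ 2 <= z ^+ 2 by rewrite ler_sqr ?nnegrE; lra.
by lra.
Qed.

End gap.

(** * Fluid solutions *)

Lemma lebesgue_ae_impl2 (R : realType) (Q1 Q2 Q : R -> Prop) :
  (forall t, Q1 t -> Q2 t -> Q t) ->
  {ae @lebesgue_measure R, forall t, Q1 t} ->
  {ae @lebesgue_measure R, forall t, Q2 t} ->
  {ae @lebesgue_measure R, forall t, Q t}.
Proof.
move=> imp N1 N2; apply: negligibleS (negligibleU N1 N2) => t /= Qt.
apply: contrapT => /not_orP[/contrapT q1 /contrapT q2]; exact/Qt/imp.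
Qed.

Lemma lebesgue_ae_impl (R : realType) (Q1 Q : R -> Prop) :
  (forall t, Q1 t -> Q t) -> {ae @lebesgue_measure R, forall t, Q1 t} ->
  {ae @lebesgue_measure R, forall t, Q t}.
Proof. by move=> imp N1; exact: (lebesgue_ae_impl2 (fun t q _ => imp t q) N1 N1). Qed.

Lemma abs_continuous_upper (R : realType) k (n : R -> 'cV[R]_k) (f : R -> R) a b C :
  0 <= C -> (forall s t, f t - f s <= C * l1norm (n t - n s)) ->
  abs_continuous_on a b n -> upper_abs_continuous f a b.
Proof.
move=> C0 fn nac e e0.
have eC0 : 0 < e / (C + 1) by rewrite divr_gt0//; lra.
have [d d0 nd] := nac _ eC0; exists d => // p u v uv uv' sd.
have := nd p (fun i => u i) (fun i => v i) (fun i => uv i (ltn_ord i)) _ sd.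
have tr : trivIset [set: 'I_p] (fun i : 'I_p => `]u i, v i[%classic).
  move=> i j _ _ [x []] /=; rewrite !in_itv/= => /andP[ui iv] /andP[uj jv].
  apply/val_inj/eqP; have [ij|ji|//] := ltngtP i j.
    by have := uv' _ _ ij (ltn_ord j); lra.
  by have := uv' _ _ ji (ltn_ord i); lra.
move=> /(_ tr); rewrite ltr_pdivlMr; last lra.
apply: le_lt_trans; rewrite mulr_suml; apply: ler_sum => i _.
apply: le_trans (fn _ _) _; rewrite mulrC ler_wpM2l ?l1norm_ge0//; lra.
Qed.

Section fluid.
Context {R : realType} (nL nR : nat) (A : 'M[R]_(nL, nR)) (c : 'cV[R]_nL).
Context (lambda mu : 'cV[R]_nR) (P : 'M[R]_nR).
Hypothesis A01 : forall l r, A l r = 0 \/ A l r = 1.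
Hypothesis A_col_neq0 : forall r, col r A != 0.
Hypothesis c_gt0 : forall l, 0 < c l 0.
Hypothesis mu_gt0 : forall r, 0 < mu r 0.
Hypothesis P_substochastic : substochastic P.
Hypothesis lambda_gt0 : forall r, 0 < lambda r 0.
Notation fluid_solution := (fluid_solution A c lambda mu P).
Notation mu_L := (@lebesgue_measure R).
Notation alloc := (pf_allocation A c).
Implicit Types (n : R -> 'cV[R]_nR) (s t h : R).

Definition drift (Phi : 'cV[R]_nR) r : R :=
  lambda r 0 - mu r 0 * Phi r 0 + \sum_s P s r * mu s 0 * Phi s 0.

Record fluid_point n t (Phi : 'cV[R]_nR) : Prop := {
  point_ge0 : nonneg_vec Phi;
  point_derive : forall r, is_derive t 1 (fun s => n s r 0) (drift Phi r);
  point_alloc : forall r, 0 < n t r 0 -> Phi r 0 = alloc (n t) r 0;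
  point_capacity : within_capacity A c Phi }.

Lemma fluid_ae_point n : fluid_solution n ->
  {ae mu_L, forall t, 0 <= t -> exists Phi, fluid_point n t Phi}.
Proof.
move=> [_ _]; apply: lebesgue_ae_impl => t H t0; have [Phi [? ? ? _ ?]] := H t0.
by exists Phi.
Qed.

Lemma fluid_ge0 n t : fluid_solution n -> 0 <= t -> nonneg_vec (n t).
Proof. by move=> [n0 _ _]; exact: n0. Qed.

(** A nonnegative function has a minimum where it vanishes; [0 < t] leaves room on both sides. *)
Lemma drift_eq0 n t Phi r : fluid_solution n -> 0 < t -> fluid_point n t Phi ->
  n t r 0 = 0 -> drift Phi r = 0.
Proof.
move=> nf t0 pt nr.
have D := point_derive pt r.
apply/eqP; rewrite eq_le; apply/andP; split; apply/ler_addgt0Pr => e e0;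
  have [d d0 nd] := is_derive_approx D e0.
- pose h := - Num.min (d / 2) (t / 2).
  have h0 : h < 0 by rewrite oppr_lt0 lt_min; apply/andP; split; lra.
  have hd : `|h| < d by rewrite ltr0_norm// opprK; have : Num.min (d / 2) (t / 2) <= d / 2 by [rewrite ge_min lexx]; lra.
  have ht : 0 <= t + h.
    by have : Num.min (d / 2) (t / 2) <= t / 2 by [rewrite ge_min lexx orbT]; rewrite /h; lra.
  have := nd h hd; rewrite nr (ltr0_norm h0) ler_norml => /andP[_ H].
  have := fluid_ge0 nf ht r => H0.
  have : (- h) * drift Phi r <= (- h) * e by lra.
  by rewrite ler_pM2l ?oppr_gt0//; lra.
- have hd : `|d / 2| < d by rewrite gtr0_norm; lra.
  have d20 : 0 < d / 2 by lra.
  have := nd (d / 2) hd; rewrite nr (gtr0_norm d20) ler_norml => /andP[_ H].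
  have := fluid_ge0 nf (ltac:(lra) : 0 <= t + d / 2) r => H0.
  have : (d / 2) * 0 <= (d / 2) * (drift Phi r + e) by lra.
  by rewrite ler_pM2l; lra.
Qed.

Lemma fluid_lipschitz : exists2 K, 0 <= K & forall n, fluid_solution n ->
  forall s t, 0 <= s -> s <= t -> l1norm (n t - n s) <= K * (t - s).
Proof.
pose C := \sum_l c l 0.
have C0 : 0 <= C by apply: sumr_ge0 => l _; exact: ltW.
have Phi_le Phi n t r : fluid_point n t Phi -> Phi r 0 <= C.
  move=> pt; have [l hl] := feasible_le A01 A_col_neq0 r (conj (point_capacity pt) (point_ge0 pt)).
  apply: le_trans hl _; rewrite /C (bigD1 l)//= lerDl sumr_ge0// => j _.
  exact: ltW.
pose K := \sum_r (lambda r 0 + mu r 0 * C) + \sum_s mu s 0 * C.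
have K0 : 0 <= K.
  by rewrite addr_ge0// sumr_ge0// => r _; rewrite ?addr_ge0 ?mulr_ge0 ?(ltW (mu_gt0 r)) ?(ltW (lambda_gt0 r)).
have drift_le Phi n t r : fluid_point n t Phi -> `|drift Phi r| <= K.
  move=> pt; have P0 := point_ge0 pt.
  have [Pge0 Ple1] := P_substochastic.
  have P1 (i j : 'I_nR) : P i j <= 1.
    by apply: le_trans (Ple1 i); rewrite (bigD1 j)//= lerDl sumr_ge0.
  have h1 : 0 <= \sum_s P s r * mu s 0 * Phi s 0.
    by apply: sumr_ge0 => s _; rewrite !mulr_ge0// ltW.
  have h2 : \sum_s P s r * mu s 0 * Phi s 0 <= \sum_s mu s 0 * C.
    apply: ler_sum => s _; apply: ler_pM => //.
    - by rewrite mulr_ge0// ltW.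
    - by rewrite ler_piMl// ltW.
    - exact: (Phi_le Phi n t).
  have h3 : 0 <= mu r 0 * Phi r 0 by rewrite mulr_ge0// ltW.
  have h4 : mu r 0 * Phi r 0 <= mu r 0 * C by rewrite ler_pM2l//; exact: (Phi_le Phi n t).
  have h5 : lambda r 0 + mu r 0 * C <= \sum_r (lambda r 0 + mu r 0 * C).
    rewrite (bigD1 r)//= lerDl sumr_ge0// => j _.
    by rewrite addr_ge0 ?mulr_ge0// ltW.
  have h6 : 0 <= \sum_s mu s 0 * C by exact: le_trans h2.
  have := lambda_gt0 r.
  by rewrite ler_norml /drift /K; lra.
exists (nR%:R * K); first by rewrite mulr_ge0.
move=> n nf s t s0 st.
have [n0 nac _] := nf.
have fac (f : R -> R) : (forall s t, f t - f s <= 1 * l1norm (n t - n s)) ->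
    upper_abs_continuous f s t.
  move=> fn e e0; have [|d d0 Hd] := abs_continuous_upper ler01 fn (nac t _) e0; first lra.
  exists d => // p u v uv; apply: Hd => i ip; have [? ? ?] := uv i ip; split => //; lra.
suff H r : `|n t r 0 - n s r 0| <= K * (t - s).
  apply: le_trans (_ : \sum_(r < nR) K * (t - s) <= _).
    by apply: ler_sum => r _; rewrite subr_mxE.
  by rewrite sumr_const card_ord -mulrA mulr_natl.
have le_r s' t' : `|n t' r 0 - n s' r 0| <= l1norm (n t' - n s').
  by have := le_l1norm (n t' - n s') r; rewrite subr_mxE.
have drift_norm := fun Phi n t pt => drift_le Phi n t r pt.
rewrite ler_norml; apply/andP; split.
- have := @abs_continuous_growth R (fun u => - n u r 0) s t K st K0.
  rewrite opprK => H; suff : - n t r 0 + n s r 0 <= K * (t - s) by lra.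
  apply: H.
    by apply: fac => s' t'; have := le_r s' t'; rewrite ler_norml mul1r; lra.
  apply: lebesgue_ae_impl (fluid_ae_point nf) => u Hu su _.
  have [|Phi pt] := Hu; first lra.
  exists (- drift Phi r); first by apply: is_deriveN; exact: (point_derive pt).
  by have := drift_norm _ _ _ pt; rewrite ler_norml; lra.
- apply: (@abs_continuous_growth R (fun u => n u r 0) s t K st K0).
    by apply: fac => s' t'; have := le_r s' t'; rewrite ler_norml mul1r; lra.
  apply: lebesgue_ae_impl (fluid_ae_point nf) => u Hu su _.
  have [|Phi pt] := Hu; first lra.
  exists (drift Phi r); first exact: (point_derive pt).
  by have := drift_norm _ _ _ pt; rewrite ler_norml; lra.
Qed.

Lemma fluid_functional_growth n (a : 'I_nR -> R) s t : fluid_solution n ->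
  0 <= s -> s <= t ->
  {ae mu_L, forall u, s <= u -> u <= t -> forall Phi, fluid_point n u Phi ->
    \sum_r a r * drift Phi r <= 0} ->
  \sum_r a r * n t r 0 <= \sum_r a r * n s r 0.
Proof.
move=> nf s0 st ha.
have [n0 nac _] := nf.
pose C := \sum_r `|a r|.
have C0 : 0 <= C by exact: sumr_ge0.
have := @abs_continuous_growth R (fun u => \sum_r a r * n u r 0) s t 0 st (lexx 0).
rewrite mul0r subr_le0; apply.
  have fn s' t' : \sum_r a r * n t' r 0 - \sum_r a r * n s' r 0 <= C * l1norm (n t' - n s').
    rewrite -sumrB mulr_suml; apply: ler_sum => r _.
    rewrite -mulrBr; apply: le_trans (ler_norm _) _; rewrite normrM ler_wpM2l//.
    by rewrite -subr_mxE le_l1norm.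
  move=> e e0; have [|d d0 Hd] := abs_continuous_upper C0 fn (nac t _) e0; first lra.
  exists d => // p u v uv; apply: Hd => i ip; have [? ? ?] := uv i ip; split => //; lra.
apply: lebesgue_ae_impl2 ha (fluid_ae_point nf) => u {}ha Hu su ut.
have [|Phi pt] := Hu; first lra.
exists (\sum_r a r * drift Phi r); last exact: ha.
have -> : (fun u => \sum_r a r * n u r 0) = \sum_(r < nR) (a r \*: (fun u : R => n u r 0)).
  by apply/funext => x; rewrite fct_sumE.
by apply: is_derive_sum => r; apply: is_deriveZ; exact: (point_derive pt).
Qed.

End fluid.

(** * Decay of the Lyapunov function along fluid solutions *)

Section convergence.
Context {R : realType} (nL nR : nat) (A : 'M[R]_(nL, nR)) (c : 'cV[R]_nL).
Context (lambda mu : 'cV[R]_nR) (P : 'M[R]_nR).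
Hypothesis A01 : forall l r, A l r = 0 \/ A l r = 1.
Hypothesis A_col_neq0 : forall r, col r A != 0.
Hypothesis c_gt0 : forall l, 0 < c l 0.
Hypothesis mu_gt0 : forall r, 0 < mu r 0.
Hypothesis P_substochastic : substochastic P.
Hypothesis IPT_unit : 1%:M - P^T \in unitmx.
Hypothesis lambda_gt0 : forall r, 0 < lambda r 0.
Hypothesis critical_load : A *m load lambda mu P = c.
Notation fluid_solution := (fluid_solution A c lambda mu P).
Notation rho := (load lambda mu P).
Notation alloc := (pf_allocation A c).
Notation price := (pf_price A c).
Notation gap := (alloc_gap A c rho).
Notation dissipation := (dissipation A c rho lambda).
Notation drift := (drift lambda mu P).
Notation fluid_point := (fluid_point A c lambda mu P).
Implicit Types (n : R -> 'cV[R]_nR) (s t h : R).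

Let rho_gt0 : forall r, 0 < rho r 0 := load_gt0 mu_gt0 P_substochastic IPT_unit lambda_gt0.

(** Empty routes have zero drift and can be added to the sum with [Phi] in place of the allocation;
    [Phi] is positive there because arrivals must be balanced. Thus [traffic_dissipation] applies to
    all routes. *)
Lemma fluid_dissipation n t Phi : fluid_solution n -> 0 < t -> fluid_point n t Phi ->
  \sum_(r | 0 < n t r 0) drift Phi r * (ln (alloc (n t) r 0) - ln (rho r 0)) <=
  - dissipation (n t).
Proof.
move=> nf t0 pt; have n0 := fluid_ge0 nf (ltW t0).
have K := pf_priceP A01 A_col_neq0 c_gt0 n0.
pose x : 'cV[R]_nR := \col_r (Phi r 0 / rho r 0).
have xE r : x r 0 = Phi r 0 / rho r 0 by rewrite mxE.
have aE r : traffic lambda P r 0 * x r 0 = mu r 0 * Phi r 0.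
  have := traffic_gt0 P_substochastic IPT_unit lambda_gt0 r; have := mu_gt0 r.
  by rewrite xE loadE => m0 a0; field; rewrite !gt_eqF.
have dE r : drift Phi r = lambda r 0 - traffic lambda P r 0 * x r 0 +
    \sum_s P s r * (traffic lambda P s 0 * x s 0).
  rewrite /drift aE; congr (_ + _); apply: eq_bigr => s _.
  by rewrite aE mulrA.
have Phi_gt0 r : 0 < Phi r 0.
  have := n0 r; rewrite le_eqVlt => /orP[/eqP nr|nr]; last first.
    by rewrite (point_alloc pt nr); have [] := kkt_gt0 A01 K nr.
  have := drift_eq0 nf t0 pt (esym nr); rewrite /drift => D.
  have : 0 <= \sum_s P s r * mu s 0 * Phi s 0.
    have [P0 _] := P_substochastic.
    by apply: sumr_ge0 => s _; rewrite !mulr_ge0 ?(point_ge0 pt)// ltW.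
  rewrite -(pmulr_rgt0 _ (mu_gt0 r)); have := lambda_gt0 r; lra.
have x_gt0 r : 0 < x r 0 by rewrite xE divr_gt0.
have := traffic_dissipation P_substochastic IPT_unit lambda_gt0 x_gt0.
have -> : \sum_r ln (x r 0) * (lambda r 0 - traffic lambda P r 0 * x r 0 +
      \sum_s P s r * (traffic lambda P s 0 * x s 0)) =
    \sum_(r | 0 < n t r 0) drift Phi r * (ln (alloc (n t) r 0) - ln (rho r 0)).
  rewrite [RHS]big_mkcond; apply: eq_bigr => r _; rewrite -dE.
  case: ltP => nr; first by rewrite -(point_alloc pt nr) -ln_div ?posrE// -xE mulrC.
  rewrite (drift_eq0 nf t0 pt) ?mulr0//; apply/eqP; rewrite eq_le nr.
  exact: n0.
move=> /le_trans; apply; rewrite lerN2 [leRHS](bigID (fun r => 0 < n t r 0))/=.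
rewrite -[leLHS]addr0; apply: lerD.
  apply: ler_sum => r nr; rewrite -(point_alloc pt nr) -ln_div ?posrE// -xE.
  exact: lexx.
apply: sumr_ge0 => r _; rewrite mulr_ge0 ?(ltW (lambda_gt0 r))//.
by rewrite subr_ge0 ln_le_subr1.
Qed.

Lemma fluid_gap_upper_dini n t : fluid_solution n -> 0 <= t ->
  exists C, exists2 d, 0 < d & forall h, 0 < h -> h < d ->
    gap (n (t + h)) <= gap (n t) + C * h.
Proof.
move=> nf t0.
have [L L0 lip] := fluid_lipschitz A01 A_col_neq0 c_gt0 mu_gt0 P_substochastic lambda_gt0.
pose X r := ln (alloc (n t) r 0) - ln (rho r 0).
exists (\sum_r (L * `|X r| + L ^+ 2 / n t r 0 + L ^+ 2 / rho r 0) + \sum_l c l 0).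
exists 1 => // h h0 h1.
have n0 := fluid_ge0 nf t0; have n'0 := fluid_ge0 nf (ltac:(lra) : 0 <= t + h).
have K := pf_priceP A01 A_col_neq0 c_gt0 n0.
have K' := pf_priceP A01 A_col_neq0 c_gt0 n'0.
(* The shift [h] matches the Lipschitz bound: a route empty at [t] contributes at most
   [(L * h) ^+ 2 / (rho_r * h)], which is of order [h]. *)
have := pf_gap_increment A01 A_col_neq0 rho_gt0 K K' h0.
rewrite -/(gap _) -/(gap _) => /le_trans; apply.
rewrite -addrA lerD2l mulrDl (mulrC h) lerD2r mulr_suml; apply: ler_sum => r _.
have dn : `|n (t + h) r 0 - n t r 0| <= L * h.
  rewrite -subr_mxE; apply: le_trans (le_l1norm _ _) _.
  by have := lip n nf t (t + h) t0 (ltac:(lra)); rewrite addrAC subrr add0r.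
have dn2 : (n (t + h) r 0 - n t r 0) ^+ 2 <= L ^+ 2 * h ^+ 2.
  rewrite -[X in X <= _]real_normK ?num_real// -exprMn ler_sqr ?nnegrE//.
  by rewrite mulr_ge0// ltW.
have LX : 0 <= L * `|X r| * h by rewrite !mulr_ge0// ltW.
have Ln : 0 <= L ^+ 2 / n t r 0 * h by rewrite !mulr_ge0 ?sqr_ge0 ?invr_ge0 ?n0// ltW.
have Lr : 0 <= L ^+ 2 / rho r 0 * h.
  by rewrite !mulr_ge0 ?sqr_ge0 ?invr_ge0 ?(ltW (rho_gt0 r))// ltW.
have hh : L ^+ 2 * h ^+ 2 <= L ^+ 2 * h.
  by rewrite ler_wpM2l ?sqr_ge0// expr2 ler_piMl// ltW.
case: ltP => nr.
  have : (n (t + h) r 0 - n t r 0) * X r <= L * `|X r| * h.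
    apply: le_trans (ler_norm _) _; rewrite normrM mulrAC.
    by rewrite ler_wpM2r.
  have : (n (t + h) r 0 - n t r 0) ^+ 2 / n t r 0 <= L ^+ 2 / n t r 0 * h.
    by rewrite [leRHS]mulrAC ler_pM2r ?invr_gt0//; lra.
  by rewrite -/(X r); lra.
have nr0 : n t r 0 = 0 by apply/eqP; rewrite eq_le nr; exact: n0.
rewrite nr0 subr0 in dn2.
have : n (t + h) r 0 ^+ 2 / (rho r 0 * h) <= L ^+ 2 / rho r 0 * h.
  rewrite ler_pdivrMr ?mulr_gt0// (_ : _ * h * _ = L ^+ 2 * h ^+ 2)//.
  by field; rewrite gt_eqF.
by lra.
Qed.

Lemma fluid_gap_dini n t Phi e : fluid_solution n -> 0 < t -> fluid_point n t Phi ->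
  0 < e -> exists2 d, 0 < d & forall h, 0 < h -> h < d ->
    gap (n (t + h)) <= gap (n t) + (e - dissipation (n t)) * h.
Proof.
move=> nf t0 pt e0.
have [L L0 lip] := fluid_lipschitz A01 A_col_neq0 c_gt0 mu_gt0 P_substochastic lambda_gt0.
pose X r := ln (alloc (n t) r 0) - ln (rho r 0).
have n0 := fluid_ge0 nf (ltW t0).
have K := pf_priceP A01 A_col_neq0 c_gt0 n0.
pose S1 := \sum_r `|X r|; have S1_ge0 : 0 <= S1 by exact: sumr_ge0.
pose S2 := \sum_r L ^+ 2 / n t r 0.
have S2_ge0 : 0 <= S2 by apply: sumr_ge0 => r _; rewrite divr_ge0 ?sqr_ge0 ?n0.
pose S3 := \sum_r (rho r 0)^-1.
have S3_ge0 : 0 <= S3 by apply: sumr_ge0 => r _; rewrite invr_ge0 ltW.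
pose S4 := \sum_l c l 0.
have S4_ge0 : 0 <= S4 by apply: sumr_ge0 => l _; exact: ltW.
(* The shift is now [kap * h]. Its cost fixes [kap]; then [e1] is taken small against [kap], because
   an initially empty route with zero drift contributes about [e1 ^+ 2 / kap]. Each of the four
   errors is at most [e / 4] times [h]. *)
pose kap := e / (4 * (S4 + 1)).
have kap0 : 0 < kap by rewrite divr_gt0//; lra.
have kapS : kap * S4 <= e / 4.
  have -> : e / 4 = kap * (S4 + 1) by rewrite /kap; field; lra.
  by rewrite ler_pM2l//; lra.
pose e1 := Num.min 1 (Num.min (e / (4 * (S1 + 1))) (kap * e / (4 * (S3 + 1)))).
have e10 : 0 < e1.
  rewrite !lt_min; apply/and3P; split; first exact: ltr01.
    by apply: divr_gt0 => //; lra.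
  by apply: divr_gt0; [exact: mulr_gt0 | lra].
have e11 : e1 <= 1 by rewrite ge_min lexx.
have e1S1 : e1 * (4 * (S1 + 1)) <= e.
  by rewrite -ler_pdivlMr ?ge_min ?lexx ?orbT//; lra.
have e1S3 : e1 * (4 * (S3 + 1)) <= kap * e.
  by rewrite -ler_pdivlMr ?ge_min ?lexx ?orbT//; lra.
have /choice[d dP] : forall r, exists d, 0 < d /\ forall h, `|h| < d ->
    `|n (t + h) r 0 - n t r 0 - h * drift Phi r| <= e1 * `|h|.
  by move=> r; have [d d0 dP] := is_derive_approx (point_derive pt r) e10; exists d.
have [d0 d0_gt0 d0_le] := pos_lower_bound (fun r => (dP r).1).
exists (Num.min d0 (e / (4 * (S2 + 1)))).
  by rewrite lt_min d0_gt0 divr_gt0//; lra.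
move=> h h0; rewrite lt_min => /andP[hd hS2].
have {}hS2 : h * S2 <= e / 4.
  move: hS2; rewrite ltr_pdivlMr; last lra.
  by lra.
have dn r : `|n (t + h) r 0 - n t r 0 - h * drift Phi r| <= e1 * h.
  have := (dP r).2 h; rewrite (gtr0_norm h0); apply.
  exact: lt_le_trans hd (d0_le r).
have n'0 := fluid_ge0 nf (ltac:(lra) : 0 <= t + h).
have K' := pf_priceP A01 A_col_neq0 c_gt0 n'0.
have kh0 : 0 < kap * h by rewrite mulr_gt0.
have := pf_gap_increment A01 A_col_neq0 rho_gt0 K K' kh0.
rewrite -/(gap _) -/(gap _) => /le_trans; apply.
rewrite -addrA lerD2l.
have main : \sum_r (if 0 < n t r 0 then (n (t + h) r 0 - n t r 0) * X r +
       (n (t + h) r 0 - n t r 0) ^+ 2 / n t r 0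
     else n (t + h) r 0 ^+ 2 / (rho r 0 * (kap * h))) <=
   h * (\sum_(r | 0 < n t r 0) drift Phi r * X r) +
   h * e1 * S1 + h * (h * S2) + h * (e1 ^+ 2 / kap * S3).
  rewrite [X in h * X + _ + _ + _]big_mkcond/= /S1 /S2 /S3 !mulr_sumr -!big_split/=.
  apply: ler_sum => r _.
  have t1 : 0 <= h * e1 * `|X r| by rewrite !mulr_ge0// ltW.
  have t2 : 0 <= h * (h * (L ^+ 2 / n t r 0)).
    by rewrite !mulr_ge0 ?sqr_ge0 ?invr_ge0 ?n0// ltW.
  have t3 : 0 <= h * (e1 ^+ 2 / kap * (rho r 0)^-1).
    by rewrite !mulr_ge0 ?sqr_ge0 ?invr_ge0 ?(ltW (rho_gt0 r)) ?(ltW kap0)// ltW.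
  case: ltP => nr.
    have : (n (t + h) r 0 - n t r 0 - h * drift Phi r) * X r <= h * e1 * `|X r|.
      apply: le_trans (ler_norm _) _; rewrite normrM ler_wpM2r//.
      by rewrite (mulrC h e1).
    have dL : `|n (t + h) r 0 - n t r 0| <= L * h.
      rewrite -subr_mxE; apply: le_trans (le_l1norm _ _) _.
      by have := lip n nf t (t + h) (ltW t0) (ltac:(lra)); rewrite addrAC subrr add0r.
    have : (n (t + h) r 0 - n t r 0) ^+ 2 / n t r 0 <= h * (h * (L ^+ 2 / n t r 0)).
      rewrite (_ : h * (h * (L ^+ 2 / n t r 0)) = (L * h) ^+ 2 / n t r 0); last first.
        by field; rewrite gt_eqF.
      rewrite ler_pM2r ?invr_gt0//.
      rewrite -[X in X <= _]real_normK ?num_real// ler_sqr ?nnegrE//.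
      by rewrite mulr_ge0// ltW.
    by lra.
  have nr0 : n t r 0 = 0 by apply/eqP; rewrite eq_le nr; exact: n0.
  have rk0 : 0 < rho r 0 * (kap * h) by exact: mulr_gt0.
  rewrite nr0 in t2; have := dn r; rewrite nr0 (drift_eq0 nf t0 pt nr0) mulr0 !subr0 => dr.
  have : n (t + h) r 0 ^+ 2 / (rho r 0 * (kap * h)) <= h * (e1 ^+ 2 / kap * (rho r 0)^-1).
    rewrite ler_pdivrMr// [leRHS](_ : _ = (e1 * h) ^+ 2); last first.
      by field; rewrite !gt_eqF.
    rewrite -[X in X <= _]real_normK ?num_real// ler_sqr ?nnegrE//.
    by rewrite mulr_ge0// ltW.
  by lra.
have diss := fluid_dissipation nf t0 pt.
rewrite -/X in diss *.
apply: le_trans (lerD main (lexx _)) _.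
have b1 : e1 * S1 <= e / 4 by lra.
have b3 : e1 ^+ 2 / kap * S3 <= e / 4.
  rewrite mulrAC ler_pdivrMr//; apply: le_trans (_ : e1 * S3 <= _); last by lra.
  by rewrite expr2 -mulrA ler_piMl// mulr_ge0// ltW.
have : h * (\sum_(r | 0 < n t r 0) drift Phi r * X r + e1 * S1 + h * S2 +
    e1 ^+ 2 / kap * S3 + kap * S4) <= h * (e - dissipation (n t)).
  by rewrite ler_pM2l//; lra.
by rewrite -/S4; lra.
Qed.

Lemma gap_decay n a b del : fluid_solution n -> 0 <= a -> a <= b -> 0 <= del ->
  (forall t, a <= t -> t <= b -> del <= dissipation (n t)) ->
  gap (n b) + del * (b - a) <= gap (n a).
Proof.
move=> nf a0 ab del0 hdel.
have [L L0 lip] := fluid_lipschitz A01 A_col_neq0 c_gt0 mu_gt0 P_substochastic lambda_gt0.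
suff : gap (n b) + del * b <= gap (n a) + del * a by rewrite mulrBr; lra.
apply: (@dini_nonincreasing R (fun t => gap (n t) + del * t) a b ab).
- move=> t a_t tb e e0.
  have e20 : 0 < e / 2 by lra.
  have n0 := fluid_ge0 nf (ltac:(lra) : 0 <= t).
  have [d d0 dP] := alloc_gap_lsc A01 A_col_neq0 c_gt0 rho_gt0 critical_load n0 e20.
  exists (Num.min t (Num.min (d / (L + 1)) (e / (2 * (del + 1))))).
    by rewrite !lt_min; apply/and3P; split; [lra| |]; rewrite divr_gt0//; lra.
  move=> s; rewrite ltrBlDr -ltrBlDl !lt_min => /and3P[h1 h2 h3] st.
  have s0 : 0 <= s by lra.
  have : l1norm (n s - n t) < d.
    rewrite l1norm_distC; apply: le_lt_trans (lip n nf s t s0 (ltW st)) _.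
    by move: h2; rewrite ltr_pdivlMr; lra.
  move=> /(dP _ (fluid_ge0 nf s0)).
  by move: h3; rewrite ltr_pdivlMr; lra.
- move=> t a_t tb; have [|C [d d0 dP]] := @fluid_gap_upper_dini n t nf; first lra.
  exists (C + del), d => // h h0 hd; have := dP h h0 hd; lra.
- apply: lebesgue_ae_impl (fluid_ae_point nf) => t Ht a_t tb e e0.
  have [|Phi pt] := Ht; first lra.
  have [|d d0 dP] := fluid_gap_dini nf _ pt e0; first lra.
  exists d => // h h0 hd; have := dP h h0 hd.
  have : h * del <= h * dissipation (n t) by rewrite ler_pM2l// hdel// ltW.
  by lra.
Qed.

End convergence.

(** * Bounds uniform over all fluid solutions *)

Section limit.
Context {R : realType} (nL nR : nat) (A : 'M[R]_(nL, nR)) (c : 'cV[R]_nL).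
Context (lambda mu : 'cV[R]_nR) (P : 'M[R]_nR).
Hypothesis A01 : forall l r, A l r = 0 \/ A l r = 1.
Hypothesis A_full_row_rank : row_free A.
Hypothesis A_col_neq0 : forall r, col r A != 0.
Hypothesis c_gt0 : forall l, 0 < c l 0.
Hypothesis mu_gt0 : forall r, 0 < mu r 0.
Hypothesis P_substochastic : substochastic P.
Hypothesis IPT_unit : 1%:M - P^T \in unitmx.
Hypothesis lambda_gt0 : forall r, 0 < lambda r 0.
Hypothesis critical_load : A *m load lambda mu P = c.
Notation fluid_solution := (fluid_solution A c lambda mu P).
Notation rho := (load lambda mu P).
Notation alloc := (pf_allocation A c).
Notation price := (pf_price A c).
Notation gap := (alloc_gap A c rho).
Notation dissipation := (dissipation A c rho lambda).
Notation drift := (drift lambda mu P).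
Notation fluid_point := (fluid_point A c lambda mu P).
Implicit Types (n : R -> 'cV[R]_nR) (s t h : R).

Let rho_gt0 : forall r, 0 < rho r 0 := load_gt0 mu_gt0 P_substochastic IPT_unit lambda_gt0.

Lemma fluid_oscillation : exists2 C, 0 <= C & forall n s t e, fluid_solution n ->
  0 <= s -> s <= t -> 0 < e ->
  (forall u, s <= u -> u <= t ->
    l1norm (n u - invariant_state A rho (price (n u))) <= e) ->
  l1norm (n t - n s) <= C * e.
Proof.
have [K K0 lip] := fluid_lipschitz A01 A_col_neq0 c_gt0 mu_gt0 P_substochastic lambda_gt0.
pose D := workload_mx mu P A; pose B := workload_price_mx lambda mu P A.
pose I := diag_mx rho^T *m A^T.
have [beta beta0 Bc] :=
  workload_price_coercive mu_gt0 P_substochastic IPT_unit lambda_gt0 A_full_row_rank.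
have [C C0 HC] := complementarity_path_oscillation beta0 Bc.
pose d := mx_l1norm D; have d0 : 0 <= d := mx_l1norm_ge0 D.
have I0 : 0 <= mx_l1norm I := mx_l1norm_ge0 I.
(* The 2 counts the passage to invariant states at both ends; the rest is the price oscillation, for
   path error [(d + 1) * e], mapped to states by [I]. *)
exists (2 + mx_l1norm I * C * (d + 1)).
  by rewrite addr_ge0// mulr_ge0 ?addr_ge0// mulr_ge0.
move=> n s t e nf s0 st e0 ne.
pose q u := price (n u); pose W u := D *m n u.
have KP u : s <= u -> pf_kkt A c (n u) (q u) (alloc (n u)).
  by move=> su; apply: pf_priceP => //; apply: (fluid_ge0 nf); lra.
have WE u l : W u l 0 = \sum_r D l r * n u r 0 by rewrite mxE.
have drain Phi u l : fluid_point n u Phi ->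
    \sum_r D l r * drift Phi r = c l 0 - (A *m Phi) l 0.
  move=> pt; pose v : 'cV[R]_nR := \col_r drift Phi r.
  have := workload_drift mu_gt0 IPT_unit A (v := v) (fun r => mxE _ _ _ _).
  rewrite critical_load => /matrixP/(_ l 0); rewrite subr_mxE => <-.
  by rewrite [RHS]mxE; apply: eq_bigr => r _; rewrite [v r 0]mxE.
have Whomo s' t' : s <= s' -> s' <= t' -> t' <= t -> forall l, W s' l 0 <= W t' l 0.
  move=> ss st' tt l; rewrite -lerN2 !WE -!sumrN.
  under eq_bigr do rewrite -mulNr; under [leRHS]eq_bigr do rewrite -mulNr.
  apply: (fluid_functional_growth nf) => //; first lra.
  apply: lebesgue_ae_impl (fluid_ae_point nf) => u _ _ _ Phi pt.
  under eq_bigr do rewrite mulNr.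
  by rewrite sumrN (drain _ _ _ pt) oppr_le0 subr_ge0 (point_capacity pt).
have path : complementarity_path B q W s t ((d + 1) * e).
  split => //.
  - by move=> u su _; exact: (kkt_q_ge0 (KP u su)).
  - move=> u su ut l; rewrite -subr_mxE; apply: le_trans (le_l1norm _ l) _.
    have -> : W u - B *m q u = D *m (n u - invariant_state A rho (q u)).
      by rewrite mulmxBr /invariant_state /B /workload_price_mx !mulmxA.
    apply: le_trans (l1norm_mulmx _ _) _; rewrite -/d.
    have : d * l1norm (n u - invariant_state A rho (q u)) <= d * e by rewrite ler_wpM2l// ne.
    lra.
  (* A positive price means that the allocation saturates link [l]. [Phi] dominates the allocation,
     which it equals on occupied routes and which is zero on empty ones, so [Phi] saturates the link
     too. *)
  - move=> s' t' l ss st' tt ql; apply/eqP; rewrite eq_le; apply/andP.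
    split; last exact: Whomo.
    rewrite !WE.
    apply: (fluid_functional_growth nf) => //; first lra.
    apply: lebesgue_ae_impl (fluid_ae_point nf) => u _ su ut Phi pt.
    rewrite (drain _ _ _ pt) subr_le0.
    have K' := KP u (ltac:(lra)).
    rewrite -(kkt_slack K' (ql u su ut)) !mxE; apply: ler_sum => r _.
    rewrite ler_wpM2l ?A_ge0//.
    have := kkt_n_ge0 K' r; rewrite le_eqVlt => /orP[/eqP nr|nr].
      by rewrite (kkt_g0 K' (esym nr)) (point_ge0 pt).
    by rewrite (point_alloc pt nr).
  - exists ((d + 1) * e / (d * K + 1)).
      by apply: divr_gt0; [apply: mulr_gt0 => //; lra|have := mulr_ge0 d0 K0; lra].
    move=> s' t' l ss st' tt; rewrite ltr_pdivlMr; last by have := mulr_ge0 d0 K0; lra.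
    move=> hst; rewrite -subr_mxE; apply: le_trans (ler_norm _) _.
    apply: le_trans (le_l1norm _ l) _; rewrite -mulmxBr.
    apply: le_trans (l1norm_mulmx _ _) _; rewrite -/d.
    have : d * l1norm (n t' - n s') <= d * (K * (t' - s')).
      by rewrite ler_wpM2l// lip//; lra.
    by lra.
have de0 : 0 < (d + 1) * e by rewrite mulr_gt0//; lra.
have hq := HC q W s t _ st de0 path.
have hI : l1norm (invariant_state A rho (q t) - invariant_state A rho (q s)) <=
    mx_l1norm I * (C * ((d + 1) * e)).
  rewrite /invariant_state -/I -mulmxBr; apply: le_trans (l1norm_mulmx _ _) _.
  by rewrite ler_wpM2l.
have ht := ne t st (lexx t); have hs := ne s (lexx s) st.
rewrite l1norm_distC in hs.
apply: le_trans (ler_l1norm_dist _ (invariant_state A rho (q t)) _) _.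
apply: le_trans (lerD ht (ler_l1norm_dist _ (invariant_state A rho (q s)) _)) _.
by lra.
Qed.

Lemma gap_nonincreasing n a b : fluid_solution n -> 0 <= a -> a <= b ->
  gap (n b) <= gap (n a).
Proof.
move=> nf a0 ab; have := gap_decay A01 A_col_neq0 c_gt0 mu_gt0 P_substochastic IPT_unit
  lambda_gt0 critical_load nf a0 ab (lexx 0).
rewrite mul0r addr0; apply => t a_t tb.
by apply: dissipation_ge0 => //; apply: (fluid_ge0 nf); lra.
Qed.

Lemma initial_gap_le M : exists2 G, 0 <= G & forall n t, fluid_solution n ->
  l1norm (n 0) < M -> 0 <= t -> gap (n t) <= G.
Proof.
pose Y := (\sum_l c l 0) * \sum_r (rho r 0)^-1.
have Y0 : 0 <= Y.
  by apply: mulr_ge0; apply: sumr_ge0 => i _; rewrite ?invr_ge0 ltW.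
exists (Y * `|M|); first by rewrite mulr_ge0.
move=> n t nf nM t0; apply: le_trans (gap_nonincreasing nf (lexx 0) t0) _.
apply: le_trans (alloc_gap_le A01 A_col_neq0 c_gt0 rho_gt0 (fluid_ge0 nf (lexx 0))) _.
by apply: ler_wpM2l => //; apply: le_trans (ler_norm M); exact: ltW.
Qed.

(** The oscillation bound involves the supremum of [l1norm (n u)] itself. This is finite on [[0, t]]
    by the Lipschitz bound, and [eta] makes its coefficient at most 1/2, so it is absorbed. *)
Lemma fluid_bounded M : exists2 Bd, 0 < Bd & forall n t, fluid_solution n ->
  l1norm (n 0) < M -> 0 <= t -> l1norm (n t) <= Bd.
Proof.
have [K K0 lip] := fluid_lipschitz A01 A_col_neq0 c_gt0 mu_gt0 P_substochastic lambda_gt0.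
have [C C0 osc] := fluid_oscillation.
have [G G0 gapG] := initial_gap_le M.
pose eta := (4 * (C + 1))^-1.
have eta0 : 0 < eta by rewrite invr_gt0//; lra.
have etaC : C * (2 * eta) <= 1 / 2.
  have : eta * (4 * (C + 1)) = 1 by rewrite mulVf// gt_eqF//; lra.
  by lra.
pose X := `|M| + C * (G / (2 * eta) + 1).
have X0 : 0 <= X.
  have : 0 <= G / (2 * eta) by rewrite divr_ge0//; lra.
  by move=> ?; rewrite addr_ge0// mulr_ge0//; lra.
exists (2 * X + 1); first lra.
move=> n t nf nM t0.
pose V := [set l1norm (n u) | u in [set u | 0 <= u <= t]].
have nu u : 0 <= u -> l1norm (n u) <= `|M| + l1norm (n u - n 0).
  move=> u0; rewrite -{1}[n u](subrK (n 0)) addrC; apply: le_trans (ler_l1normD _ _) _.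
  by rewrite lerD2r; apply: le_trans (ler_norm M); exact: ltW.
have hV : has_sup V.
  split; first by exists (l1norm (n 0)); exists 0 => //=; rewrite lexx.
  exists (`|M| + K * t) => _ [u /andP[u0 ut] <-].
  apply: le_trans (nu u u0) _; rewrite lerD2l.
  apply: le_trans (lip n nf 0 u (lexx 0) u0) _.
  by rewrite subr0 ler_wpM2l.
have Vle u : 0 <= u -> u <= t -> l1norm (n u) <= sup V.
  by move=> u0 ut; apply: (ub_le_sup hV.2); exists u => //=; rewrite u0.
have S0 : 0 <= sup V by apply: le_trans (l1norm_ge0 _) (Vle 0 (lexx 0) t0).
have Gn0 : 0 <= G / (2 * eta) by rewrite divr_ge0//; lra.
suff : sup V <= X + sup V / 2 by have := Vle t t0 (lexx t); lra.
apply: ge_sup; first exact: hV.1.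
move=> _ [u /andP[u0 ut] <-]; apply: le_trans (nu u u0) _.
have eV : 0 <= 2 * eta * sup V by rewrite !mulr_ge0// ltW.
have e0 : 0 < G / (2 * eta) + 2 * eta * sup V + 1 by lra.
have := osc n 0 u _ nf (lexx 0) u0 e0; rewrite /X.
have : C * (2 * eta) * sup V <= 1 / 2 * sup V by rewrite ler_wpM2r.
suff H w : 0 <= w -> w <= u -> l1norm (n w - invariant_state A rho (price (n w))) <=
    G / (2 * eta) + 2 * eta * sup V + 1.
  by move=> h /(_ H); lra.
move=> w0 wu.
have := dist_invariant_le A01 A_col_neq0 c_gt0 rho_gt0 critical_load (fluid_ge0 nf w0) eta0.
have : gap (n w) / (2 * eta) <= G / (2 * eta).
  by rewrite ler_pM2r ?invr_gt0 ?gapG//; lra.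
have : 2 * eta * l1norm (n w) <= 2 * eta * sup V.
  by rewrite ler_pM2l ?Vle//; lra.
by lra.
Qed.

Lemma gap_vanishes M e : 0 < e -> exists2 T, 0 <= T & forall n t, fluid_solution n ->
  l1norm (n 0) < M -> T <= t -> gap (n t) <= e.
Proof.
move=> e0; have [Bd Bd0 nB] := fluid_bounded M.
have [G G0 gapG] := initial_gap_le M.
have [del del0 hdel] := dissipation_lower_bound A01 A_col_neq0 c_gt0 rho_gt0 lambda_gt0 Bd0 e0.
(* If the gap stayed above [e] up to this time, it would lose [del * T = G + del], more than its
   initial bound. *)
exists (G / del + 1); first by rewrite addr_ge0// divr_ge0// ltW.
set T := _ + 1; have T0 : 0 <= T by rewrite addr_ge0// divr_ge0// ltW.
move=> n t nf nM Tt; apply: le_trans (gap_nonincreasing nf T0 Tt) _.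
rewrite leNgt; apply/negP => eT.
have := gap_decay A01 A_col_neq0 c_gt0 mu_gt0 P_substochastic IPT_unit
  lambda_gt0 critical_load nf (lexx 0) T0 (ltW del0).
have : 0 <= gap (n T).
  exact: (alloc_gap_ge0 A01 A_col_neq0 c_gt0 rho_gt0 critical_load (fluid_ge0 nf T0)).
have := gapG n 0 nf nM (lexx 0).
have : del * T = G + del by rewrite /T; field; rewrite gt_eqF.
rewrite subr0 => h1 h2 h3 H.
suff /H : forall u, 0 <= u -> u <= T -> del <= dissipation (n u) by lra.
move=> u u0 uT; apply: hdel; [exact: (fluid_ge0 nf)|exact: nB|].
by have := gap_nonincreasing nf u0 uT; lra.
Qed.

End limit.

Theorem theorem5p1 (R : realType) (nL nR : nat) (A : 'M[R]_(nL, nR))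
    (c : 'cV[R]_nL) (lambda mu : 'cV[R]_nR) (P : 'M[R]_nR)
    (A01 : forall l r, A l r = 0 \/ A l r = 1)
    (A_full_row_rank : row_free A)
    (A_col_neq0 : forall r, col r A != 0)
    (c_gt0 : forall l, 0 < c l 0)
    (mu_gt0 : forall r, 0 < mu r 0)
    (P_substochastic : substochastic P)
    (IPT_unit : 1%:M - P^T \in unitmx)
    (lambda_gt0 : forall r, 0 < lambda r 0)
    (critical_load : A *m load lambda mu P = c)
    (M : R) (M_gt0 : 0 < M) (eps : R) (eps_gt0 : 0 < eps) :
  exists2 T : R, 0 <= T &
    forall n : R -> 'cV[R]_nR,
      fluid_solution A c lambda mu P n -> l1norm (n 0) < M ->
      exists2 ninf : 'cV[R]_nR, nonneg_vec ninf &
        forall t : R, T < t -> l1norm (n t - ninf) < eps.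
Proof.
have [C C0 osc] := fluid_oscillation A01 A_full_row_rank A_col_neq0 c_gt0 mu_gt0
  P_substochastic IPT_unit lambda_gt0 critical_load.
have [Bd Bd0 nB] := fluid_bounded A01 A_full_row_rank A_col_neq0 c_gt0 mu_gt0
  P_substochastic IPT_unit lambda_gt0 critical_load M.
pose C1 := C + 1; have C10 : 0 < C1 by rewrite /C1; lra.
(* [eta] and [eg] make each of [eg / (2 * eta)] and [2 * eta * Bd] equal to [eps / (4 * C1)]; using
   [C1] instead of [C] permits the division. *)
pose eta := eps / (8 * C1 * Bd).
have eta0 : 0 < eta by rewrite divr_gt0// !mulr_gt0.
pose eg := eta * eps / (2 * C1).
have eg0 : 0 < eg by apply: divr_gt0; exact: mulr_gt0.
have [T T0 gapT] := gap_vanishes A01 A_full_row_rank A_col_neq0 c_gt0 mu_gt0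
  P_substochastic IPT_unit lambda_gt0 critical_load M eg0.
exists T => // n nf nM.
exists (n T); first exact: fluid_ge0 nf T0.
move=> t Tt.
have e1 : C1 * (eg / (2 * eta) + 2 * eta * Bd) = eps / 2.
  by rewrite /eg /eta; field; rewrite !gt_eqF.
have e0 : 0 < eg / (2 * eta) + 2 * eta * Bd.
  by rewrite -(pmulr_rgt0 _ C10) e1; lra.
apply: le_lt_trans (osc n T t _ nf T0 (ltW Tt) e0 _) _; last first.
  by move: e1; rewrite /C1; lra.
move=> u Tu ut; have u0 : 0 <= u by lra.
have rho_gt0 := load_gt0 mu_gt0 P_substochastic IPT_unit lambda_gt0.
apply: le_trans (dist_invariant_le A01 A_col_neq0 c_gt0 rho_gt0 critical_load
  (fluid_ge0 nf u0) eta0) _.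
apply: lerD.
  by rewrite ler_pM2r ?invr_gt0 ?gapT//; lra.
by rewrite ler_pM2l ?nB//; lra.
Qed.
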